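(* Let $\pi=(\pi^{ij})$ be a (smooth) Poisson structure on $\mathbb{R}^d$, and let $\overline{V}=-\pi^{ij}(x)p_i\partial_{x^j}$ be regarded as a vector field on $\mathbb{R}^d$ depending on the parameter $p$. For a topological rooted tree $t$ set $$c_t=\sum_{P\in\mathcal{P}(t)}(-1)^{|P_t|}\prod_{\tau\in t\backslash P}\frac{1}{\tau!\,(|\tau|+1)}.$$ Then the formal power series $$\alpha^i_\epsilon(x,p)=x^i+\sum_{t\in[RT]}\frac{\epsilon^{|t|}}{\sigma(t)}\,c_t\,D^i_t\overline{V}\qquad(i=1,\dots,d)$$ define a formal symplectic realization $\alpha_\epsilon:(T^*\mathbb{R}^d,\omega_0)\to(\mathbb{R}^d,\epsilon\pi)$. Moreover, this $\alpha_\epsilon$ coincides with the formal Karasev realization, i.e. the unique formal series of the form $x+O(\epsilon)$ satisfying $\phi_\epsilon(\alpha_\epsilon(x,p),p)=x$ for all $p$.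
   Context: Coordinates on $T^*\mathbb{R}^d$ are $(x,p)$; repeated indices are summed. $\omega_0=dp_i\wedge dx^i$, with Poisson bracket $\{f,g\}_{\omega_0}=\partial_{x^i}f\,\partial_{p_i}g-\partial_{p_i}f\,\partial_{x^i}g$ (so $\{x^i,p_j\}=\delta^i_j$). Formal composition: for $w_\epsilon^i=w_0^i+\epsilon\tilde w_\epsilon^i$ with $w_0^i\in C^\infty(T^*\mathbb{R}^d)$, $\tilde w^i_\epsilon\in C^\infty(T^*\mathbb{R}^d)[[\epsilon]]$, and $f\in C^\infty(T^*\mathbb{R}^d)$, the expression $f(w_\epsilon(x,p),p)$ means $\sum_{n\ge0}\frac{\epsilon^n}{n!}\tilde w_\epsilon^{i_1}\cdots\tilde w_\epsilon^{i_n}\big[\partial_{x^{i_1}}\cdots\partial_{x^{i_n}}f\big](w_0(x,p),p)$, extended $\epsilon$-linearly to formal series $f$. A formal symplectic realization $s_\epsilon:(T^*\mathbb{R}^d,\omega_0)\to(\mathbb{R}^d,\epsilon\pi)$ is a formal power series $s_\epsilon=x+\epsilon s_{(1)}+\epsilon^2 s_{(2)}+\cdots$ with smooth $\mathbb{R}^d$-valued coefficients $s_{(k)}$ on $T^*\mathbb{R}^d$ satisfying $\{s^i_\epsilon,s^j_\epsilon\}_{\omega_0}(x,p)=\epsilon\,\pi^{ij}(s_\epsilon(x,p))$ at each order in $\epsilon$. $\phi_\epsilon^i(x,p)=\sum_{n\ge0}\frac{\epsilon^n}{(n+1)!}(L_{\overline V})^n(x^i)$, where $L_{\overline V}f=-\pi^{ij}(x)p_i\,\partial_{x^j}f$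 (this is the formal expansion of $\frac1\epsilon\int_0^\epsilon(\varphi^{\overline V}_s)^*x^i\,ds$, $\varphi_s^{\overline V}$ the flow of $\overline V$). Trees: $[RT]$ is the set of isomorphism classes of (nonempty, finite) rooted trees, called topological rooted trees; $|t|$ is the number of vertices; $\sigma(t)$ is the number of automorphisms of the rooted tree $t$; $\bullet$ is the one-vertex tree; $[t_1,\dots,t_m]$ is the tree obtained by grafting the roots of $t_1,\dots,t_m$ onto a new root (order irrelevant). The tree factorial is $\bullet!=1$, $[t_1,\dots,t_m]!=|t|\,t_1!\cdots t_m!$ for $t=[t_1,\dots,t_m]$. $\mathcal{P}(t)$ is the set of all subsets $P$ (including the empty set) of the set of edges of $t$; $t\backslash P$ is the forest of rooted trees obtained from $t$ by erasing the edges in $P$ (each component rooted at its vertex closest to the root of $t$); $P_t$ is the tree obtained by contracting each tree of $t\backslash P$ to a single vertex and re-establishing the edges of $P$, and $|P_t|$ is its number of vertices. Elementary differentials of a vector field $X=X^i\partial_i$ on $\mathbb{R}^d$: $D^u_\bullet X=X^u(x)$ and $D^u_{[t_1,\dots,t_m]}X=\partial_{i_1}\cdots\partial_{i_m}X^u(x)\,D^{i_1}_{t_1}X\cdots D^{i_m}_{t_m}X$. For $\overline V$, the derivatives are in $x$ with $p$ held fixed. *)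

(* Defs.v *)
(* MathComp-Analysis *)
From HB Require Import structures.
From mathcomp Require Import all_boot all_order all_algebra perm generic_quotient.
From mathcomp Require Import finmap.
From mathcomp Require Import all_classical all_reals all_analysis.

Set Implicit Arguments.
Unset Strict Implicit.
Unset Printing Implicit Defensive.

Import Order.TTheory GRing.Theory Num.Theory.
Import numFieldNormedType.Exports.

Local Open Scope ring_scope.

(** * Rooted trees *)

(* Finite rooted trees carrying an (irrelevant) ordering of the children of each
   vertex; the ordering is forgotten by passing to isomorphism classes below. *)
Inductive rtree := Node of seq rtree.

Definition rtree_ind_all (Q : rtree -> Prop)
    (H : forall ts, foldr (fun t => and (Q t)) True ts -> Q (Node ts)) :
    forall t, Q t :=
  fix ih t := let: Node ts := t in
    H ts ((fix ihs ts := match ts return foldr (fun t => and (Q t)) True ts with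
       | [::] => I
       | t :: ts' => conj (ih t) (ihs ts') end) ts).

Fixpoint rtree_enc (t : rtree) : GenTree.tree unit :=
  let: Node ts := t in GenTree.Node 0 (map rtree_enc ts).

Fixpoint rtree_dec (g : GenTree.tree unit) : rtree :=
  if g is GenTree.Node _ gs then Node (map rtree_dec gs) else Node [::].

Lemma rtree_encK : cancel rtree_enc rtree_dec.
Proof.
elim/rtree_ind_all => ts IH /=; congr Node.
by elim: ts IH => //= t ts ih [-> /ih ->].
Qed.

HB.instance Definition _ := Countable.copy rtree (can_type rtree_encK).

Definition indexed (T : Type) (s : seq T) : seq (nat * T) :=
  zip (iota 0 (size s)) s.

(* A vertex is named by its address: [::] is the root, and the vertex with
   address a in the i-th child of the root has address i :: a. *)
Fixpoint addresses (t : rtree) : seq (seq nat) :=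
  let: Node ts := t in
  [::] :: flatten [seq [seq p.1 :: a | a <- p.2]
                  | p <- indexed (map addresses ts)].

Definition vertices (t : rtree) : {fset seq nat} := [fset a in addresses t]%fset.

(* An edge is named by the address of its endpoint farther from the root. *)
Definition edges (t : rtree) : {fset seq nat} :=
  [fset a in addresses t | a != [::]]%fset.

Definition is_parent (a b : seq nat) : bool :=
  if b is i :: b' then a == belast i b' else false.

Fixpoint nb_vertices (t : rtree) : nat :=
  let: Node ts := t in (sumn (map nb_vertices ts)).+1.

Fixpoint tree_fact (t : rtree) : nat :=
  let: Node ts := t in
  (nb_vertices (Node ts) * \prod_(n <- map tree_fact ts) n)%N.

(* the root goes to the root, and edges correspond to edges *)
Definition rooted_map (t u : rtree) (f : vertices t -> vertices u) : Prop :=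
  (forall v, (fsval (f v) == [::]) = (fsval v == [::])) /\
  (forall v w, is_parent (fsval (f v)) (fsval (f w)) =
               is_parent (fsval v) (fsval w)).

Definition isomorphic (t u : rtree) : Prop :=
  exists f : vertices t -> vertices u, bijective f /\ rooted_map f.

Definition sigma (t : rtree) : nat :=
  #|[set s : {perm vertices t} | `[< rooted_map s >]]|.

Definition isomorphicb (t u : rtree) : bool := `[< isomorphic t u >].

Lemma isomorphicb_refl : reflexive isomorphicb.
Proof. by move=> t; apply/asboolP; exists id; split=> //; exists id. Qed.

Lemma isomorphicb_sym : symmetric isomorphicb.
Proof.
have imp t u : isomorphic t u -> isomorphic u t.
  move=> [f [[g fK gK] [fr fp]]]; exists g; split; first by exists f.
  by split=> [v|v w]; rewrite -?fr -?fp !gK.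
by move=> t u; apply/asboolP/asboolP; apply: imp.
Qed.

Lemma isomorphicb_trans : transitive isomorphicb.
Proof.
move=> u t v /asboolP[f [bf [fr fp]]] /asboolP[g [bg [gr gp]]].
apply/asboolP; exists (g \o f); split; first exact: bij_comp.
by split=> [x|x y] /=; rewrite ?gr ?gp.
Qed.

Definition isomorphic_equiv : equiv_rel rtree :=
  EquivRel isomorphicb isomorphicb_refl isomorphicb_sym isomorphicb_trans.

Definition RT : Type := {eq_quot isomorphic_equiv}%qT.
HB.instance Definition _ := Quotient.on RT.
HB.instance Definition _ := Choice.on RT.
HB.instance Definition _ := EqQuotient.on RT.

(* Some tree in the class; every quantity evaluated at it below only depends on
   the class (for elementary differentials, by symmetry of partial derivatives). *)
Definition rep (t : RT) : rtree := repr t.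

Definition RT_of_size (k : nat) : set RT :=
  [set t | nb_vertices (rep t) = k]%classic.

Lemma finite_seq_le (T : Type) (A : set T) (n : nat) : finite_set A ->
  finite_set
    [set s | (size s <= n)%N /\ foldr (fun x => and (A x)) True s]%classic.
Proof.
move=> finA; elim: n => [|n ihn].
  by apply: (sub_finite_set _ (finite_set1 [::])) => -[|x s] [].
apply: (@sub_finite_set _ _ ([set [::]] `|`
    [set x :: s | x in A & s in
      [set s | (size s <= n)%N /\ foldr (fun x => and (A x)) True s]])%classic).
  case=> [|x s] /= [szs As]; [by left|right].
  by case: As => Ax As; exists x => //; exists s.
by rewrite finite_setU; split; [exact: finite_set1|exact: finite_image2].
Qed.

Lemma finite_rtree_le (k : nat) :
  finite_set [set t | (nb_vertices t <= k)%N]%classic.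
Proof.
elim: k => [|k ihk].
  by apply: (sub_finite_set _ (finite_set0 _)) => -[].
apply: (sub_finite_set _ (finite_image Node (finite_seq_le k ihk))) => -[ts] /= H.
exists ts => //; rewrite ltnS in H; split.
  by apply: leq_trans H; elim: ts => //= -[us] ts ih /=;
      rewrite addSn ltnS (leq_trans ih) ?leq_addl.
elim: ts H => //= t ts ih H; split; first exact: leq_trans (leq_addr _ _) H.
exact/ih/(leq_trans (leq_addl _ _) H).
Qed.

(* so the sum over RT_of_size k in alpha is not the default value 0 *)
Lemma finite_RT_of_size (k : nat) : finite_set (RT_of_size k).
Proof.
apply: (sub_finite_set _ (finite_image (\pi_RT)%qT (finite_rtree_le k))) => t /= <-.
by exists (rep t) => //=; exact: reprK.
Qed.

(* For a set P of edges of t, the forest t \ P obtained by erasing the edges of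
   P, as the pair of the component of the root of t and the list of the others. *)
Fixpoint cut_edges (t : rtree) (P : pred (seq nat)) : rtree * seq rtree :=
  let: Node ts := t in
  let rs := [seq (P [:: p.1], p.2 (fun a => P (p.1 :: a)))
            | p <- indexed (map cut_edges ts)] in
  (Node [seq r.2.1 | r <- rs & ~~ r.1],
   flatten [seq (if r.1 then r.2.1 :: r.2.2 else r.2.2) | r <- rs]).

Definition erase (t : rtree) (P : pred (seq nat)) : seq rtree :=
  (cut_edges t P).1 :: (cut_edges t P).2.

Definition subtrees (t : rtree) : seq rtree := let: Node ts := t in ts.

(* The tree P_t obtained by contracting the edges of t which are not in P. *)
Fixpoint contract_edges (t : rtree) (P : pred (seq nat)) : rtree :=
  let: Node ts := t in
  Node (flatten
    [seq (let u := p.2 (fun a => P (p.1 :: a)) in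
          if P [:: p.1] then [:: u] else subtrees u)
    | p <- indexed (map contract_edges ts)]).

Definition tree_coef (R : realType) (t : rtree) : R :=
  \sum_(P <- fpowerset (edges t))
    (-1) ^+ nb_vertices (contract_edges t (mem P)) *
    \prod_(tau <- erase t (mem P))
      (1 / (tree_fact tau * (nb_vertices tau).+1)%N%:R).

(** * Smooth functions on R^d and on T^*R^d *)

Section Calculus.
Context {R : realType}.

(* C^oo: all iterated directional derivatives exist and are continuous (used for
   finite-dimensional V, where partial derivatives would give the same notion). *)
Definition smooth (V : normedModType R) (f : V -> R) : Prop :=
  forall vs : seq V,
    let g := foldr (fun v h => 'D_v h) f vs in
    continuous g /\ forall v z, derivable g z v.

Variable d : nat.

(* T^*R^d, with points z = (x, p) = (z.1, z.2). *)
Definition cotangent : normedModType R := ('rV[R]_d * 'rV[R]_d)%type.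

Definition basis_vec (i : 'I_d) : 'rV[R]_d := delta_mx 0 i.

Definition d_x (i : 'I_d) (f : cotangent -> R) : cotangent -> R :=
  'D_((basis_vec i, 0) : cotangent) f.

Definition d_p (i : 'I_d) (f : cotangent -> R) : cotangent -> R :=
  'D_((0, basis_vec i) : cotangent) f.

Definition d_xs (I : seq 'I_d) (f : cotangent -> R) : cotangent -> R :=
  foldr d_x f I.

Definition coord_x (i : 'I_d) : cotangent -> R := fun z => z.1 0 i.

Definition bracket (f g : cotangent -> R) : cotangent -> R := fun z =>
  \sum_i (d_x i f z * d_p i g z - d_p i f z * d_x i g z).

Definition poisson_structure (pi : 'I_d -> 'I_d -> 'rV[R]_d -> R) : Prop :=
  [/\ forall i j, smooth (pi i j),
      forall i j x, pi i j x = - pi j i x &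
      forall i j k x,
        \sum_l (pi i l x * 'D_(basis_vec l) (pi j k) x +
                pi j l x * 'D_(basis_vec l) (pi k i) x +
                pi k l x * 'D_(basis_vec l) (pi i j) x) = 0].

(** * Formal power series with coefficients functions on T^*R^d *)

Definition fseries : Type := nat -> cotangent -> R.

Definition fsmooth (F : fseries) : Prop := forall k, smooth (F k).

Definition fconst (f : cotangent -> R) : fseries :=
  fun k z => if k is 0%N then f z else 0.

Definition fmul (F G : fseries) : fseries := fun k z =>
  \sum_(a < k.+1) F a z * G (k - a)%N z.

Definition feps (F : fseries) : fseries := fun k z =>
  if k is k'.+1 then F k' z else 0.

Definition fbracket (F G : fseries) : fseries := fun k z =>
  \sum_(a < k.+1) bracket (F a) (G (k - a)%N) z.

(* f(w(x,p),p) for w = w_0 + eps * wt, where wt k := w k.+1: the coefficient of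
   eps^k is
     \sum_(n <= k) 1/n! \sum_(i_1,..,i_n)
       [coefficient of eps^(k-n) in wt^i_1 ... wt^i_n]
       * (d_x^i_1 ... d_x^i_n f)(w_0(x,p),p). *)
Definition fcomp0 (f : cotangent -> R) (w : 'I_d -> fseries) : fseries :=
  let wt i : fseries := fun k => w i k.+1 in
  fun k z => \sum_(n < k.+1) (n`!%:R)^-1 *
    \sum_(I : n.-tuple 'I_d)
      (\big[fmul/fconst (fun=> 1)]_(i <- I) wt i) (k - n)%N z *
      d_xs I f (\row_i w i 0%N z, z.2).

Definition fcomp (F : fseries) (w : 'I_d -> fseries) : fseries := fun k z =>
  \sum_(m < k.+1) fcomp0 (F m) w (k - m)%N z.

(* smooth series of the form x + O(eps) *)
Definition near_identity (s : 'I_d -> fseries) : Prop :=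
  forall i, fsmooth (s i) /\ forall z, s i 0%N z = coord_x i z.

Definition formal_symplectic_realization
    (pi : 'I_d -> 'I_d -> 'rV[R]_d -> R) (s : 'I_d -> fseries) : Prop :=
  near_identity s /\
  forall i j k z, fbracket (s i) (s j) k z =
                  feps (fcomp0 (fun y => pi i j y.1) s) k z.

(** * The vector field, phi, and the Karasev equation *)

Definition Vbar (pi : 'I_d -> 'I_d -> 'rV[R]_d -> R) (j : 'I_d) :
    cotangent -> R := fun z => - \sum_i pi i j z.1 * z.2 0 i.

Definition L_Vbar (pi : 'I_d -> 'I_d -> 'rV[R]_d -> R)
    (f : cotangent -> R) : cotangent -> R := fun z =>
  - \sum_i \sum_j pi i j z.1 * z.2 0 i * d_x j f z.

Definition phi (pi : 'I_d -> 'I_d -> 'rV[R]_d -> R) (i : 'I_d) : fseries :=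
  fun n z => ((n.+1)`!%:R)^-1 * iter n (L_Vbar pi) (coord_x i) z.

Definition karasev_equation (pi : 'I_d -> 'I_d -> 'rV[R]_d -> R)
    (s : 'I_d -> fseries) : Prop :=
  forall i k z, fcomp (phi pi i) s k z = fconst (coord_x i) k z.

Definition formal_karasev_realization (pi : 'I_d -> 'I_d -> 'rV[R]_d -> R)
    (s : 'I_d -> fseries) : Prop :=
  [/\ near_identity s, karasev_equation pi s &
      forall s', near_identity s' -> karasev_equation pi s' ->
        forall i k z, s' i k z = s i k z].

(** * Elementary differentials *)

(* X is a vector field on R^d depending on the parameter p; p is held fixed. *)
Fixpoint eldiff (X : 'I_d -> cotangent -> R) (t : rtree) (u : 'I_d) :
    cotangent -> R :=
  let: Node ts := t in
  let Ds := map (eldiff X) ts in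
  fun z => \sum_(I : (size ts).-tuple 'I_d)
    d_xs I (X u) z * \prod_(q <- zip I Ds) q.2 q.1 z.

Definition alpha (pi : 'I_d -> 'I_d -> 'rV[R]_d -> R) (i : 'I_d) : fseries :=
  fun k z => fconst (coord_x i) k z +
    \sum_(t \in RT_of_size k)
      (sigma (rep t))%:R^-1 * tree_coef R (rep t) *
      eldiff (Vbar pi) (rep t) i z.

End Calculus.

(* Main.v *)
(* Karasev => symplectic: writing L for the derivation given by Vbar
   and {,} for the bracket of pi with p held fixed, phi = sum L^n x / (n+1)!
   satisfies d_(p_j) phi^i - d_(p_i) phi^j = eps {phi^i, phi^j}, because
   [d_(p_j), L] f = - {x^j, f} and L is a derivation of {,} (Jacobi).  Differentiating
   phi(alpha(x,p),p) = x expresses the derivatives of alpha through those of phi, and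
   this identity becomes {alpha^i, alpha^j} = eps pi^ij(alpha).

   alpha solves the Karasev equation: let c_t(s) be the polynomials with
   c_t' = prod c_(t_i) for t = [t_1, ..., t_m] and zero mean over [0, 1].  The B-series
   Z_s with coefficients c_t(s) is a solution of Z' = eps Vbar(Z), so that
   Z_s = (exp(s eps L) x)(Z_0); averaging over s in [0, 1] gives x = phi(Z_0).
   Splitting the sum over the edge sets P according to the component of the root
   shows that c_t(0) is the coefficient of alpha, i.e. that Z_0 = alpha.

   Sums over isomorphism classes weighted by 1/sigma(t) are turned into sums over
   plane trees u weighted by w(u) = prod_v 1/(number of children of v)!, by means of
   sum_u w(u) #Iso(t, u) = 1, which follows by induction from the expansion of
   #Iso([t_1, ..., t_m], [u_1, ..., u_m]) along the image of t_1. *)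

From HB Require Import structures.
Require Import Defs.
From mathcomp Require Import all_boot all_order all_algebra perm generic_quotient.
From mathcomp Require Import finmap.
From mathcomp Require Import all_classical all_reals all_analysis.
From mathcomp Require Import ring zify.

Set Implicit Arguments.
Unset Strict Implicit.
Unset Printing Implicit Defensive.

Import Order.TTheory GRing.Theory Num.Theory.
Import numFieldNormedType.Exports.

Local Open Scope ring_scope.

(** * Symmetry of second derivatives *)

(** Schwarz's theorem makes the directional derivatives commuting derivations of the ring of smooth
    functions; after that the argument is algebra. Composition with x + eps w is a ring morphism
    with a chain rule, used in two places: over the smooth functions, and at a fixed point z with
    coefficients in R[s], s being the time. In R[s] no flow has to be integrated, because order k in
    eps of f(Z_s) is a polynomial killed by k + 1 time derivatives.

    Origin of the cut sum: the flow started at x has coefficients s^|t| / t!, of mean 1 / (t! (|t| +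
    1)). Imposing zero mean at each vertex in the recursion c_t' = prod c_(t_i) replaces a branch
    either by its attached polynomial or by minus an average. Expanding these choices gives one term
    for each set of cut edges and one sign for each cut component. At s = 0 the polynomial of the
    root component vanishes, so that component too must be replaced by minus its average; this
    leaves exactly c_t. *)

Section Schwarz.
Context {R : realType} {V : normedModType R}.
Implicit Types (f : V -> R) (u v w z : V).

Lemma derivable_shift f u z v :
  derivable f (z + u) v -> derivable (fun y => f (y + u)) z v.
Proof. by rewrite /derivable /shift /=; under eq_fun do rewrite /= addrA. Qed.

Lemma derive_shift f u z v : 'D_v (fun y => f (y + u)) z = 'D_v f (z + u).
Proof. by rewrite /derive /shift /=; under eq_fun do rewrite /= -addrA. Qed.

Lemma is_derive_line f z v (t : R) : derivable f (z + t *: v) v ->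
  is_derive t 1 (fun s => f (z + s *: v)) ('D_v f (z + t *: v)).
Proof.
move=> df; have E : (fun h : R => h^-1 *:
    (((fun s => f (z + s *: v)) \o shift t) (h *: 1) - f (z + t *: v))) =
  (fun h : R => h^-1 *:
    ((f \o shift (z + t *: v)) (h *: v) - f (z + t *: v))).
  apply/funext => h /=; rewrite [h *: 1]mulr1 scalerDl.
  by rewrite (addrCA z) (addrC z).
by split; rewrite /derivable /derive E.
Qed.

Lemma MVT_line f z v (h : R) : 0 < h -> (forall y, derivable f y v) ->
  exists2 c, 0 < c < h & f (z + h *: v) - f z = h * 'D_v f (z + c *: v).
Proof.
move=> h0 df; have D t := is_derive_line (df (z + t *: v)).
have [|c] := @MVT R (fun s => f (z + s *: v)) _ 0 h h0 (fun t _ => D t).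
  apply: continuous_subspaceT => t; apply: differentiable_continuous.
  by apply/derivable1_diffP; case: (D t).
rewrite in_itv /= scale0r addr0 subr0 mulrC => ch ->.
by exists c.
Qed.

(** The mean value theorem is used twice: along v for the difference between the translate of f by h
    w and f, then along w for 'D_v f. *)
Lemma second_difference f z v w (h : R) : 0 < h -> (forall y, derivable f y v) ->
    (forall y, derivable ('D_v f) y w) ->
  exists c e, [/\ 0 < c < h, 0 < e < h &
    f (z + h *: v + h *: w) - f (z + h *: v) - (f (z + h *: w) - f z) =
      h * (h * 'D_w ('D_v f) (z + c *: v + e *: w))].
Proof.
move=> h0 df ddf.
have dsh y : derivable (fun y => f (y + h *: w)) y v.
  exact/derivable_shift.
have dg y : derivable ((fun y => f (y + h *: w)) - f) y v by apply: derivableB.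
have [c ch Ec] := MVT_line z h0 dg.
have [e eh Ee] := MVT_line (z + c *: v) h0 ddf.
exists c, e; split=> //; rewrite -Ee -derive_shift -deriveB //.
Qed.

Lemma near_parallelogram (g : V -> R) z v w (e : R) : 0 < e ->
  {for z, continuous g} -> exists2 h0 : R, 0 < h0 & forall h c c' : R,
    0 < h < h0 -> 0 < c < h -> 0 < c' < h ->
    `|g z - g (z + c *: v + c' *: w)| < e.
Proof.
move=> e0 /cvgr_dist_lt /(_ e e0) /nbhs_ballP[r /= r0 B].
(* The summand 1 keeps the denominator of the witness positive when v and w both vanish. *)
have n0 : 0 < `|v| + `|w| + 1 by rewrite ltr_wpDl // addr_ge0.
exists (r / (`|v| + `|w| + 1)); first by rewrite divr_gt0.
move=> h c c' /andP[hp]; rewrite ltr_pdivlMr // => hr.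
move=> /andP[cp ch] /andP[cp' ch'].
apply: B; rewrite -ball_normE /ball_ /= opprD addrA opprD addrA subrr add0r.
apply: le_lt_trans (ler_normD _ _) _; rewrite !normrN !normrZ.
rewrite (gtr0_norm cp) (gtr0_norm cp'); apply: le_lt_trans hr.
rewrite !mulrDr mulr1 -[leLHS]addr0 lerD ?(ltW hp) // lerD //.
  by rewrite ler_wpM2r // ltW.
by rewrite ler_wpM2r // ltW.
Qed.

(** The second difference is symmetric in v and w, so for each small h the two mixed derivatives
    share a value, at two different points near z. If they differed at z, continuity would keep each
    within half the gap of its value there. *)
Lemma derive_comm f z v w :
    (forall y, derivable f y v) -> (forall y, derivable f y w) ->
    (forall y, derivable ('D_v f) y w) -> (forall y, derivable ('D_w f) y v) ->
    {for z, continuous ('D_w ('D_v f))} -> {for z, continuous ('D_v ('D_w f))} ->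
  'D_w ('D_v f) z = 'D_v ('D_w f) z.
Proof.
move=> dv dw dvw dwv cvw cwv.
apply/eqP; rewrite -subr_eq0 -normr_le0 leNgt; apply/negP => ab.
set a := 'D_w ('D_v f) z in ab *; set b := 'D_v ('D_w f) z in ab *.
have e0 : 0 < `|a - b| / 2 by rewrite divr_gt0.
have [h1 h10 H1] := near_parallelogram v w e0 cvw.
have [h2 h20 H2] := near_parallelogram w v e0 cwv.
have [h0 hh1 hh2] : exists2 h, 0 < h & 0 < h < h1 /\ 0 < h < h2.
  exists (Num.min h1 h2 / 2); first by rewrite divr_gt0 // lt_min h10 h20.
  have m0 : 0 < Num.min h1 h2 / 2 by rewrite divr_gt0 // lt_min h10 h20.
  have m1 : Num.min h1 h2 / 2 < Num.min h1 h2.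
    by rewrite ltr_pdivrMr // ltr_pMr ?lt_min ?h10 ?h20 // ltr1n.
  by rewrite m0 /= !(lt_le_trans m1) // ge_min lexx // orbT.
have [c [c' [ch ch' E1]]] := second_difference z hh1 dv dvw.
have [e [e' [eh eh' E2]]] := second_difference z hh1 dw dwv.
have {E2} : h0 * (h0 * 'D_w ('D_v f) (z + c *: v + c' *: w)) =
       h0 * (h0 * 'D_v ('D_w f) (z + e *: w + e' *: v)).
  have swap (A B C D : R) : A - B - (C - D) = A - C - (B - D) by ring.
  apply: etrans (esym E1) _; apply: etrans _ E2.
  by rewrite (addrAC z (h0 *: w)); exact: swap.
have eq_bound (A B C D : R) : C = D -> `|A - C| < `|A - B| / 2 ->
    `|B - D| < `|A - B| / 2 -> False.
  move=> -> B1 B2; have := ler_distD D A B; rewrite leNgt => /negP; apply.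
  by rewrite [ltRHS]splitr ltrD // distrC.
have h0n : h0 != 0 by rewrite gt_eqF.
move=> /(mulfI h0n) /(mulfI h0n) E.
have B1 := H1 _ _ _ hh2.1 ch ch'; have B2 := H2 _ _ _ hh2.2 eh eh'.
exact: eq_bound E B1 B2.
Qed.

End Schwarz.

(** * The ring of smooth functions *)

Section Smooth.
Context {R : realType} {V : normedModType R}.
Implicit Types f g : V -> R.

(** Smoothness order by order: closure under products then needs the Leibniz rule for one derivative
    at a time. *)
Fixpoint smooth_upto (n : nat) f : Prop :=
  [/\ continuous f, forall v z, derivable f z v &
      if n is n'.+1 then forall v, smooth_upto n' ('D_v f) else True].

Lemma smooth_derive f v : smooth f -> smooth ('D_v f).
Proof. by move=> sf vs; have := sf (rcons vs v); rewrite foldr_rcons. Qed.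

Lemma smoothP f : smooth f <-> forall n, smooth_upto n f.
Proof.
split=> [sf n|H vs].
  elim: n f sf => [|n ih] f sf; have [cf df] := sf [::]; split=> // v.
  exact/ih/smooth_derive.
elim/last_ind: vs f H => [|vs v ih] f H /=; first by have [] := H 0%N.
by rewrite foldr_rcons; apply: ih => n; have [_ _ Hn] := H n.+1; exact: Hn.
Qed.

Lemma smooth_continuous f : smooth f -> continuous f.
Proof. by move=> sf; have [] := sf [::]. Qed.

Lemma smooth_derivable f v z : smooth f -> derivable f z v.
Proof. by move=> sf; have [_] := sf [::]; apply. Qed.

Lemma smooth_upto_le m n f : (m <= n)%N -> smooth_upto n f -> smooth_upto m f.
Proof.
elim: m n f => [|m ih] [|n] f //= mn [cf df H]; split=> // v.
exact: ih mn (H v).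
Qed.

Lemma smooth_upto_cst n (c : R) : smooth_upto n (cst c : V -> R).
Proof.
elim: n c => [|n ih] c; split=> //; try exact: cst_continuous.
move=> v; suff -> : 'D_v (cst c : V -> R) = cst 0 by exact: ih.
by apply/funext => z; exact: derive_cst.
Qed.

Lemma smooth_uptoD n f g :
  smooth_upto n f -> smooth_upto n g -> smooth_upto n (f + g).
Proof.
move=> sf sg; elim: n f g sf sg => [|n ih] f g [cf df Hf] [cg dg Hg].
  split=> [z|v z|//]; last exact: derivableD.
  by exact: (continuousD (cf z) (cg z)).
split=> [z|v z|v]; [|exact: derivableD|].
  by exact: (continuousD (cf z) (cg z)).
rewrite (_ : 'D_v (f + g) = 'D_v f + 'D_v g); first exact: ih (Hf v) (Hg v).
by apply/funext => z; rewrite deriveD.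
Qed.

Lemma smooth_uptoM n f g :
  smooth_upto n f -> smooth_upto n g -> smooth_upto n (f * g).
Proof.
elim: n f g => [|n ih] f g sf sg; have [cf df Hf] := sf; have [cg dg Hg] := sg.
  split=> [z|v z|//]; last exact: derivableM.
  by exact: (continuousM (cf z) (cg z)).
split=> [z|v z|v]; [|exact: derivableM|].
  by exact: (continuousM (cf z) (cg z)).
rewrite (_ : 'D_v (f * g) = f * 'D_v g + g * 'D_v f); last first.
  by apply/funext => z; rewrite deriveM.
by apply: smooth_uptoD; apply: ih;
  [exact: smooth_upto_le sf|exact: Hg|exact: smooth_upto_le sg|exact: Hf].
Qed.

Lemma smooth_cst (c : R) : smooth (cst c : V -> R).
Proof. by apply/smoothP => n; exact: smooth_upto_cst. Qed.

Lemma smoothD f g : smooth f -> smooth g -> smooth (f + g).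
Proof.
by move=> /smoothP sf /smoothP sg; apply/smoothP => n; exact: smooth_uptoD.
Qed.

Lemma smoothM f g : smooth f -> smooth g -> smooth (f * g).
Proof.
by move=> /smoothP sf /smoothP sg; apply/smoothP => n; exact: smooth_uptoM.
Qed.

Lemma smooth_derive_comm f v w : smooth f -> 'D_w ('D_v f) = 'D_v ('D_w f).
Proof.
move=> sf; have D u := smooth_derive u sf.
by apply/funext => z; apply: derive_comm => [y|y|y|y||];
  (exact: smooth_derivable || exact/smooth_continuous/smooth_derive/smooth_derive).
Qed.

Lemma smooth_affine f : continuous f ->
  (forall v, exists c, forall z, is_derive z v f c) -> smooth f.
Proof.
move=> cf df; apply/smoothP => n.
have d' v z : derivable f z v by have [c Dc] := df v; case: (Dc z).
case: n => [|n]; split=> // v; have [c Dc] := df v.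
rewrite (_ : 'D_v f = cst c); first exact: smooth_upto_cst.
by apply/funext => z; case: (Dc z).
Qed.

Definition smooth_pred : {pred V -> R} := fun f => `[< smooth f >].

Lemma smooth_subring : subring_closed smooth_pred.
Proof.
split=> [|f g|f g].
- by apply/asboolP; exact: (smooth_cst 1).
- move=> /asboolP sf /asboolP sg; apply/asboolP.
  rewrite (_ : f - g = f + cst (-1) * g).
    by apply: smoothD sf (smoothM (smooth_cst (-1)) sg).
  by apply/funext => z; rewrite -[LHS]/(f z - g z) -[RHS]/(f z + -1 * g z) mulN1r.
- by move=> /asboolP sf /asboolP sg; apply/asboolP; exact: smoothM.
Qed.

HB.instance Definition _ :=
  GRing.isSubringClosed.Build (V -> R) smooth_pred smooth_subring.

End Smooth.

Section SmoothRing.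
Context (R : realType) (d : nat).
Local Notation T := (@cotangent R d).

(** Bundling gives a commutative ring on which the partial derivatives are total operations and
    derivations. *)
Record smoothfun := SmoothFun {
  smoothfun_val :> T -> R;
  smoothfun_valP : smoothfun_val \in smooth_pred }.

HB.instance Definition _ := [isSub for smoothfun_val].
HB.instance Definition _ := [Choice of smoothfun by <:].
HB.instance Definition _ := [SubChoice_isSubComNzRing of smoothfun by <:].
End SmoothRing.

(** * Formal power series *)

(** A separate name for sequences, so that the product can be the Cauchy product instead of the
    pointwise one. *)
Definition ser (K : Type) : Type := nat -> K.

Section SeriesRing.
Variable K : comNzRingType.
Implicit Types F G H : ser K.

HB.instance Definition _ := GRing.Zmodule.copy (ser K) (nat -> K).

Lemma serP F G : (forall n, F n = G n) -> F = G.
Proof. by move/funext. Qed.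

Lemma serD F G n : (F + G) n = F n + G n. Proof. by []. Qed.
Lemma serN F n : (- F) n = - F n. Proof. by []. Qed.
Definition ser_one : ser K := fun n => (n == 0%N)%:R.
Definition ser_mul F G : ser K := fun n => \sum_(a < n.+1) F a * G (n - a)%N.

(** Truncation to polynomials lets the ring axioms be inherited from {poly K}. *)
Lemma ser_mul_poly F G N n : (n < N)%N ->
  (\poly_(i < N) F i * \poly_(i < N) G i)`_n = ser_mul F G n.
Proof.
move=> nN; rewrite coefM; apply: eq_bigr => a _.
rewrite !coef_poly (leq_ltn_trans (leq_ord a) nN).
by rewrite (leq_ltn_trans (leq_subr a n) nN).
Qed.

Lemma ser_mulC : commutative ser_mul.
Proof.
by move=> F G; apply/funext => n; rewrite -!(@ser_mul_poly _ _ n.+1) // mulrC.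
Qed.

Lemma ser_mulA : associative ser_mul.
Proof.
move=> F G H; apply/funext => n.
have lt_ord m (a : 'I_m.+1) : (m < n.+1)%N -> (a < n.+1)%N /\ (m - a < n.+1)%N.
  by move=> mn; split; [exact: leq_ltn_trans (leq_ord a) mn|
                        exact: leq_ltn_trans (leq_subr a m) mn].
transitivity ((\poly_(i < n.+1) F i * (\poly_(i < n.+1) G i *
               \poly_(i < n.+1) H i))`_n).
  rewrite coefM; apply: eq_bigr => a _; have [an bn] := lt_ord n a (ltnSn n).
  by rewrite ser_mul_poly // coef_poly an.
rewrite mulrA coefM; apply: eq_bigr => a _; have [an bn] := lt_ord n a (ltnSn n).
by rewrite ser_mul_poly // coef_poly bn.
Qed.

Lemma ser_mul1 : left_id ser_one ser_mul.
Proof.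
move=> F; apply/funext => n; rewrite /ser_mul big_ord_recl subn0 mul1r.
by rewrite big1 ?addr0 // => a _; rewrite mul0r.
Qed.

Lemma ser_mulDl : left_distributive ser_mul +%R.
Proof.
move=> F G H; apply/funext => n; rewrite serD /ser_mul -big_split /=.
by apply: eq_bigr => a _; rewrite -mulrDl.
Qed.

Lemma ser_one_neq0 : ser_one != 0.
Proof.
apply/eqP => /(congr1 (fun F : ser K => F 0%N)) /eqP.
by rewrite /ser_one /= oner_eq0.
Qed.

HB.instance Definition _ := GRing.Zmodule_isComNzRing.Build (ser K)
  ser_mulA ser_mulC ser_mul1 ser_mulDl ser_one_neq0.

Lemma ser1 n : (1 : ser K) n = (n == 0%N)%:R. Proof. by []. Qed.
Lemma serM F G n : (F * G) n = \sum_(a < n.+1) F a * G (n - a)%N.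
Proof. by []. Qed.

Lemma ser_sum (I : Type) (r : seq I) (P : pred I) (E : I -> ser K) n :
  (\sum_(i <- r | P i) E i) n = \sum_(i <- r | P i) E i n.
Proof. by elim/big_rec2: _ => // i x y _ <-. Qed.

Definition serC (c : K) : ser K := fun n => if n is 0%N then c else 0.
Definition serX : ser K := fun n => (n == 1%N)%:R.

Lemma serCM c F n : (serC c * F) n = c * F n.
Proof.
rewrite serM big_ord_recl subn0 big1 ?addr0 // => a _.
by rewrite /serC /= mul0r.
Qed.

Lemma serXM F n : (serX * F) n = if n is m.+1 then F m else 0.
Proof.
rewrite serM; case: n => [|n]; first by rewrite big_ord1 mul0r.
rewrite big_ord_recl mul0r add0r big_ord_recl mul1r subSS subn0 big1 ?addr0 //.
by move=> a _; rewrite mul0r.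
Qed.

Lemma serXnM F m n :
  (serX ^+ m * F) n = if (m <= n)%N then F (n - m)%N else 0.
Proof.
elim: m n => [|m ih] n; first by rewrite mul1r subn0.
rewrite exprS -mulrA serXM; case: n => // n; rewrite ih ltnS.
Qed.

Lemma serC_zmod : zmod_morphism serC.
Proof. by move=> a b; apply/serP => -[|n]; rewrite serD serN //= subr0. Qed.
Lemma serC_monoid : monoid_morphism serC.
Proof.
by split=> [|a b]; apply/serP => -[|n] //; rewrite serCM //= mulr0.
Qed.
HB.instance Definition _ := GRing.isZmodMorphism.Build K (ser K) serC serC_zmod.
HB.instance Definition _ := GRing.isMonoidMorphism.Build K (ser K) serC serC_monoid.

End SeriesRing.

Section SeriesMap.
Variables (K L : comNzRingType).

Definition ser_map (f : K -> L) (F : ser K) : ser L := fun n => f (F n).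

Lemma ser_mapE (f : K -> L) F n : ser_map f F n = f (F n). Proof. by []. Qed.

Variable f : {rmorphism K -> L}.
Lemma ser_map_zmod : zmod_morphism (ser_map f).
Proof. by move=> F G; apply/serP => n; rewrite /ser_map !serD !serN rmorphB. Qed.
Lemma ser_map_monoid : monoid_morphism (ser_map f).
Proof.
split=> [|F G]; apply/serP => n; rewrite /ser_map; first by rewrite !ser1 rmorph_nat.
by rewrite !serM rmorph_sum; apply: eq_bigr => a _; rewrite rmorphM.
Qed.
HB.instance Definition _ :=
  GRing.isZmodMorphism.Build (ser K) (ser L) (ser_map f) ser_map_zmod.
HB.instance Definition _ :=
  GRing.isMonoidMorphism.Build (ser K) (ser L) (ser_map f) ser_map_monoid.
End SeriesMap.

Section Diagonal.
Variable K : comNzRingType.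
Implicit Types G H : ser (ser K).

(** Sets the two variables of a double series equal. *)
Definition diag G : ser K := fun n => \sum_(a < n.+1) G a (n - a)%N.

Lemma coef_hornerX (Q : {poly {poly K}}) n :
  Q.['X]`_n = \sum_(a < n.+1) Q`_a`_(n - a).
Proof.
rewrite (@horner_coef_wide _ (maxn n.+1 (size Q))) ?leq_maxr // coef_sum.
rewrite (eq_bigr (fun a : 'I__ => if (a < n.+1)%N then Q`_a`_(n - a) else 0)).
  rewrite -big_mkcond /=.
  by rewrite (big_ord_widen (maxn n.+1 (size Q)) (fun a => Q`_a`_(n - a)))
     ?leq_maxl.
by move=> a _; rewrite coefMXn ltnS; case: (leqP a n).
Qed.

Lemma diag_zmod : zmod_morphism diag.
Proof.
move=> G H; apply/serP => n; rewrite serD serN /diag -sumrN -big_split.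
by apply: eq_bigr.
Qed.

(** On truncations, [diag] is evaluation of a polynomial over {poly K} at 'X, which is
    multiplicative. *)
Lemma diag_monoid : monoid_morphism diag.
Proof.
split=> [|G H]; apply/serP => n.
  rewrite /diag big_ord_recl subn0 big1 ?addr0 //.
pose P (G : ser (ser K)) := \poly_(a < n.+1) \poly_(b < n.+1) G a b.
have PE G' a b : (a < n.+1)%N -> (b < n.+1)%N -> (P G')`_a`_b = G' a b.
  by move=> an bn; rewrite coef_poly an coef_poly bn.
have PX G' m : (m < n.+1)%N -> (P G').['X]`_m = diag G' m.
  move=> mn; rewrite coef_hornerX; apply: eq_bigr => a _.
  by rewrite PE // (leq_ltn_trans _ mn) ?leq_ord ?leq_subr.
transitivity ((P G * P H).['X]`_n).
  rewrite coef_hornerX; apply: eq_bigr => i _.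
  rewrite coefM serM coef_sum ser_sum; apply: eq_bigr => j _.
  rewrite coefM serM; apply: eq_bigr => b _.
  have := ltn_ord i; have := ltn_ord j; have := ltn_ord b => bn jn In.
  by rewrite !PE //; lia.
rewrite hornerM coefM serM; apply: eq_bigr => i _.
by rewrite !PX // ?ltnS ?leq_subr.
Qed.

HB.instance Definition _ :=
  GRing.isZmodMorphism.Build (ser (ser K)) (ser K) diag diag_zmod.
HB.instance Definition _ :=
  GRing.isMonoidMorphism.Build (ser (ser K)) (ser K) diag diag_monoid.

Lemma diagC (F : ser K) : diag (serC F) = F.
Proof.
apply/serP => n; rewrite /diag big_ord_recl subn0 big1 ?addr0 // => a _.
Qed.

Lemma diagX : diag (serX _) = serX K.
Proof.
apply/serP => -[|n]; rewrite /diag; first by rewrite big_ord1.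
rewrite !big_ord_recl big1 ?addr0 => [|a _]; last by rewrite /serX.
by rewrite [X in X + _]/= add0r /= subSS subn0.
Qed.

End Diagonal.

(** * Formal substitution *)

Definition derivation (K : comNzRingType) (D : K -> K) : Prop :=
  (forall a b, D (a + b) = D a + D b) /\ forall a b, D (a * b) = D a * b + a * D b.

Section Derivation.
Variables (K : comNzRingType) (D : K -> K).
Hypothesis HD : derivation D.

Lemma derD a b : D (a + b) = D a + D b. Proof. exact: HD.1. Qed.
Lemma derM a b : D (a * b) = D a * b + a * D b. Proof. exact: HD.2. Qed.
Lemma der0 : D 0 = 0.
Proof. by apply: (addrI (D 0)); rewrite -derD !addr0. Qed.
Lemma derN a : D (- a) = - D a.
Proof. by apply: (addrI (D a)); rewrite -derD !subrr der0. Qed.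
Lemma derB a b : D (a - b) = D a - D b.
Proof. by rewrite derD derN. Qed.
Lemma der1 : D 1 = 0.
Proof. by apply: (addrI (D 1)); rewrite addr0 -{3}[1]mulr1 derM mulr1 mul1r. Qed.
Lemma der_sum (I : Type) (r : seq I) (P : pred I) (E : I -> K) :
  D (\sum_(i <- r | P i) E i) = \sum_(i <- r | P i) D (E i).
Proof.
by elim/big_rec2: _ => [|i x y _ <-]; [exact: der0|rewrite derD].
Qed.
Lemma derMn a n : D (a *+ n) = D a *+ n.
Proof. by elim: n => [|n ih]; rewrite ?der0 // !mulrS derD ih. Qed.
Lemma der_nat n : D n%:R = 0.
Proof. by rewrite derMn der1 mul0rn. Qed.

(** Lets the inverse factorials, given only as ring elements, pass through derivations as
    constants. *)
Lemma der_natV n c : n%:R * c = 1 -> D c = 0.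
Proof.
move=> nc; have /(congr1 D) := nc; rewrite derM der_nat mul0r add0r der1.
by move=> /(congr1 ( *%R c)); rewrite mulr0 mulrA (mulrC c) nc mul1r.
Qed.

Lemma derMl c a : D c = 0 -> D (c * a) = c * D a.
Proof. by move=> Dc; rewrite derM Dc mul0r add0r. Qed.

Lemma derivation_ser_map : derivation (ser_map D).
Proof.
split=> F G; apply/serP => n; rewrite /ser_map; first by rewrite !serD derD.
rewrite serD !serM der_sum -big_split.
by apply: eq_bigr => a _; rewrite derM.
Qed.

Lemma ser_map_diag (G : ser (ser K)) :
  ser_map D (diag G) = diag (ser_map (ser_map D) G).
Proof. by apply/serP => n; rewrite /ser_map /diag der_sum. Qed.

End Derivation.

Section Taylor.
Variables (A : comNzRingType) (d : nat) (dd : 'I_d -> A -> A) (invfact : nat -> A).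
Hypothesis Hdd : forall i, derivation (dd i).
Hypothesis ddC : forall i j f, dd i (dd j f) = dd j (dd i f).
Hypothesis invfactP : forall n, n`!%:R * invfact n = 1.

Section Defs.
Variables (K : comNzRingType) (ev : {rmorphism A -> K}) (wt : 'I_d -> ser K).

Fixpoint taylor_sum (n : nat) (f : A) : ser K :=
  if n is n'.+1 then \sum_i wt i * taylor_sum n' (dd i f) else serC (ev f).

(** The outer index is the order of the Taylor term, the inner one the power of eps coming from wt;
    taking the diagonal restores the eps^n in front of order n. *)
Definition taylor (f : A) : ser (ser K) :=
  fun n => serC (ev (invfact n)) * taylor_sum n f.

(* With x the base point behind [ev], this is f(x + eps * wt). *)
Definition subst (f : A) : ser K := diag (taylor f).

Lemma taylor_sumB n f g : taylor_sum n (f - g) = taylor_sum n f - taylor_sum n g.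
Proof.
elim: n f g => [|n ih] f g /=; first by rewrite !rmorphB.
rewrite -sumrB; apply: eq_bigr => i _.
by rewrite (derB (Hdd i)) ih mulrBr.
Qed.

Lemma taylor_sum0 n : taylor_sum n 0 = 0.
Proof. by have := taylor_sumB n 0 0; rewrite !subrr. Qed.

Lemma taylor_sum1 n : taylor_sum n 1 = (n == 0%N)%:R.
Proof.
case: n => [|n] /=; first by rewrite !rmorph1.
rewrite big1 // => i _; rewrite (der1 (Hdd i)).
by rewrite taylor_sum0 mulr0.
Qed.

Lemma taylor_sumD n f g : taylor_sum n (f + g) = taylor_sum n f + taylor_sum n g.
Proof. by rewrite -{1}[g]opprK -[- g]sub0r !taylor_sumB taylor_sum0 sub0r opprK. Qed.

Lemma taylor_sumM n f g : taylor_sum n (f * g) =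
  \sum_(a < n.+1) (taylor_sum a f * taylor_sum (n - a) g) *+ 'C(n, a).
Proof.
elim: n f g => [|n ih] f g; first by rewrite big_ord1 /= !rmorphM.
rewrite /=; transitivity (\sum_(a < n.+1)
    (taylor_sum a.+1 f * taylor_sum (n - a) g +
     taylor_sum a f * taylor_sum (n - a).+1 g) *+ 'C(n, a)).
  under eq_bigr => i _ do rewrite (derM (Hdd i)) taylor_sumD !ih -big_split
    mulr_sumr /=.
  rewrite exchange_big /=; apply: eq_bigr => a _.
  rewrite mulr_suml mulr_sumr -big_split -sumrMnl; apply: eq_bigr => i _ /=.
  by rewrite -mulrnDl mulrnAr; congr (_ *+ _); ring.
rewrite (eq_bigr (fun a : 'I__ =>
  (taylor_sum a.+1 f * taylor_sum (n - a) g) *+ 'C(n, a) +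
  (taylor_sum a f * taylor_sum (n.+1 - a) g) *+ 'C(n, a))); last first.
  by move=> a _; rewrite mulrnDl subSn ?leq_ord.
rewrite big_split /= [RHS]big_ord_recl [X in _ + X]big_ord_recl.
rewrite !bin0 addrCA; congr (_ + _).
rewrite big_ord_recr /= [X in _ = X]big_ord_recr /=.
rewrite !binn addrAC -!big_split; congr (_ + _).
apply: eq_bigr => a _; rewrite /bump !add0n !add1n subSS binS mulrnDr.
exact: addrC.
Qed.

Lemma invfactM n a : (a <= n)%N ->
  invfact n * 'C(n, a)%:R = invfact a * invfact (n - a).
Proof.
move=> an; transitivity (n`!%:R * invfact n * (invfact a * invfact (n - a))).
  rewrite -(bin_fact an) !natrM.
  transitivity ((a`!%:R * invfact a) * ((n - a)`!%:R * invfact (n - a)) *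
    (invfact n * 'C(n, a)%:R)); last by ring.
  by rewrite !invfactP !mul1r.
by rewrite invfactP mul1r.
Qed.

(** The binomials of the Leibniz rule cancel against the inverse factorials. This is why formal
    composition is a ring morphism. *)
Lemma taylorM f g : taylor (f * g) = taylor f * taylor g.
Proof.
apply/serP => n; rewrite serM /taylor taylor_sumM mulr_sumr.
apply: eq_bigr => a _; rewrite -mulr_natr.
have -> : ('C(n, a)%:R : ser K) = serC (ev 'C(n, a)%:R) by rewrite !rmorph_nat.
rewrite mulrCA -rmorphM -rmorphM /= invfactM ?leq_ord // !rmorphM /=; ring.
Qed.

Lemma taylor_zmod : zmod_morphism taylor.
Proof. by move=> f g; apply/serP => n; rewrite serD serN /taylor taylor_sumB mulrBr. Qed.

Lemma taylor1 : taylor 1 = 1.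
Proof.
apply/serP => -[|n]; rewrite /taylor taylor_sum1 ser1 /= ?mulr0 // mulr1.
by have := invfactP 0; rewrite fact0 mul1r => ->; rewrite !rmorph1.
Qed.

Lemma subst_zmod : zmod_morphism subst.
Proof. by move=> f g; rewrite /subst taylor_zmod rmorphB. Qed.

Lemma subst_monoid : monoid_morphism subst.
Proof. by split=> [|f g]; rewrite /subst ?taylor1 ?rmorph1 // taylorM rmorphM. Qed.

Definition subst_rmorphism : {rmorphism A -> ser K} :=
  HB.pack subst (GRing.isZmodMorphism.Build A (ser K) subst subst_zmod)
    (GRing.isMonoidMorphism.Build A (ser K) subst subst_monoid).

Definition subst_ser (F : ser A) : ser K := diag (ser_map subst_rmorphism F).

Lemma subst_ser_zmod : zmod_morphism subst_ser.
Proof. by move=> F G; rewrite /subst_ser !rmorphB. Qed.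

Lemma subst_ser_monoid : monoid_morphism subst_ser.
Proof. by split=> [|F G]; rewrite /subst_ser ?rmorph1 // !rmorphM. Qed.

HB.instance Definition _ :=
  GRing.isZmodMorphism.Build (ser A) (ser K) subst_ser subst_ser_zmod.
HB.instance Definition _ :=
  GRing.isMonoidMorphism.Build (ser A) (ser K) subst_ser subst_ser_monoid.

Lemma subst_serC f : subst_ser (serC f) = subst f.
Proof.
apply/serP => n; rewrite /subst_ser /diag big_ord_recl subn0 big1 ?addr0 //.
by move=> a _; rewrite /ser_map [serC f _]/= rmorph0.
Qed.

Lemma subst_serX : subst_ser (serX A) = serX K.
Proof.
rewrite /subst_ser -[RHS]diagX; congr diag; apply/serP => n.
by rewrite /ser_map /serX rmorph_nat.
Qed.

Lemma subst_coord j f : (forall i, dd i f = (i == j)%:R) ->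
  subst f = serC (ev f) + serX K * wt j.
Proof.
move=> df; have t n : taylor_sum n f = if n is n'.+1 then
    if n' is _.+1 then 0 else wt j else serC (ev f).
  case: n => // n /=; rewrite (bigD1 j) //= df eqxx big1 => [|i ij].
    by rewrite taylor_sum1; case: n => [|n]; rewrite ?mulr0 ?mulr1 ?addr0.
  by rewrite df (negbTE ij) taylor_sum0 mulr0.
have i0 : invfact 0 = 1 by have := invfactP 0; rewrite fact0 mul1r.
have i1 : invfact 1 = 1 by have := invfactP 1; rewrite mul1r.
rewrite /subst (_ : taylor f = serC (serC (ev f)) + serX _ * serC (wt j)).
  by rewrite rmorphD rmorphM /= !diagC diagX.
apply/serP => n; rewrite serD serXM /taylor t.
by case: n => [|[|n]]; rewrite /= ?i0 ?i1 ?rmorph1 ?mul1r ?addr0 ?add0r ?mulr0.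
Qed.

Lemma subst_const c : (forall i, dd i c = 0) -> subst c = serC (ev c).
Proof.
move=> dc; have i0 : invfact 0 = 1 by have := invfactP 0; rewrite fact0 mul1r.
rewrite -[RHS]diagC /subst; congr diag; apply/serP => -[|n].
  by rewrite /taylor i0 !rmorph1 mul1r.
by rewrite /taylor /= big1 ?mulr0 // => i _; rewrite dc taylor_sum0 mulr0.
Qed.

Section Chain.
Variables (D : K -> K) (E : A -> A).
Hypotheses (HD : derivation D) (DE : forall f, D (ev f) = ev (E f)).
Hypothesis EC : forall i f, E (dd i f) = dd i (E f).

Local Notation D' := (ser_map D).
Let HD' : derivation D' := derivation_ser_map HD.

Lemma ser_map_serC c : D' (serC c) = serC (D c).
Proof. by apply/serP => -[|n] //; exact: der0. Qed.

Lemma ser_map_taylor_sum n f : D' (taylor_sum n f) =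
  (\sum_j D' (wt j) * taylor_sum n.-1 (dd j f)) *+ n + taylor_sum n (E f).
Proof.
elim: n f => [|n ih] f; first by rewrite mulr0n add0r /= ser_map_serC DE.
rewrite /= (der_sum HD').
rewrite (eq_bigr _ (fun i _ => derM HD' (wt i) (taylor_sum n (dd i f)))) /=.
under eq_bigr => i _ do rewrite ih EC mulrDr.
rewrite big_split /= mulrS -addrA; congr (_ + _).
rewrite big_split /=; congr (_ + _).
case: n {ih} => [|n]; first by rewrite mulr0n big1 // => i _; rewrite mulr0n mulr0.
under eq_bigr => i _ do rewrite mulrnAr mulr_sumr.
rewrite sumrMnl exchange_big; congr (_ *+ _); apply: eq_bigr => j _.
rewrite mulr_sumr; apply: eq_bigr => i _ /=.
by rewrite ddC mulrCA.
Qed.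

Lemma invfactS n : invfact n.+1 *+ n.+1 = invfact n.
Proof.
transitivity (n`!%:R * invfact n * (n.+1%:R * invfact n.+1)).
  by rewrite invfactP mul1r mulr_natl.
transitivity (invfact n * ((n.+1)`!%:R * invfact n.+1)).
  by rewrite factS natrM; ring.
by rewrite invfactP mulr1.
Qed.

Lemma ser_map_taylor f : ser_map D' (taylor f) =
  serX _ * (\sum_j serC (D' (wt j)) * taylor (dd j f)) + taylor (E f).
Proof.
apply/serP => n; rewrite serD serXM ser_mapE /taylor (derM HD').
rewrite ser_map_serC (der_natV HD (_ : n`!%:R * _ = 1)); last first.
  by rewrite -[n`!%:R](rmorph_nat ev) -rmorphM invfactP rmorph1.
rewrite rmorph0 mul0r add0r ser_map_taylor_sum mulrDr; congr (_ + _).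
case: n => [|n]; first by rewrite mulr0n mulr0.
rewrite ser_sum mulrnAr -mulrnAl -!rmorphMn invfactS /= mulr_sumr.
by apply: eq_bigr => j _; rewrite serCM mulrCA.
Qed.

(** Chain rule; E is the action of D through the base point. It is used with E = D over the smooth
    functions, and with E = 0 for the time derivative, where the base point does not move. *)
Lemma subst_chain f : ser_map D (subst f) =
  serX K * (\sum_j D' (wt j) * subst (dd j f)) + subst (E f).
Proof.
rewrite /subst (ser_map_diag HD) ser_map_taylor rmorphD rmorphM /= diagX.
rewrite rmorph_sum; congr (_ * _ + _); apply: eq_bigr => j _.
by rewrite rmorphM /= diagC.
Qed.

Lemma subst_ser_chain F : ser_map D (subst_ser F) =
  serX K * (\sum_j D' (wt j) * subst_ser (ser_map (dd j) F)) +
  subst_ser (ser_map E F).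
Proof.
rewrite /subst_ser (ser_map_diag HD).
rewrite (_ : ser_map D' _ = serC (serX K) *
  (\sum_j serC (D' (wt j)) * ser_map subst_rmorphism (ser_map (dd j) F)) +
  ser_map subst_rmorphism (ser_map E F)).
  rewrite rmorphD rmorphM /= diagC rmorph_sum; congr (_ * _ + _).
  by apply: eq_bigr => j _; rewrite rmorphM /= diagC.
apply/serP => n; rewrite serD serCM !ser_mapE [LHS]subst_chain ser_sum.
by congr (_ * _ + _); apply: eq_bigr => j _; rewrite serCM.
Qed.

End Chain.
End Defs.

Lemma eq_taylor_sum_upto (K : comNzRingType) (ev : {rmorphism A -> K}) wt wt' n k f :
  (forall j m, (m <= k)%N -> wt j m = wt' j m) ->
  taylor_sum ev wt n f k = taylor_sum ev wt' n f k.
Proof.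
elim: n k f => [|n ih] k f H //=; rewrite !ser_sum; apply: eq_bigr => i _.
rewrite !serM; apply: eq_bigr => a _.
rewrite H ?leq_ord // ih // => j m mk; apply: H.
by rewrite (leq_trans mk) // leq_subr.
Qed.

(** The bound is strict because every factor wt is accompanied by an eps; this gain of one order
    drives the uniqueness proof. *)
Lemma eq_subst_upto (K : comNzRingType) (ev : {rmorphism A -> K}) wt wt' k f :
  (forall j m, (m < k)%N -> wt j m = wt' j m) ->
  subst ev wt f k = subst ev wt' f k.
Proof.
move=> H; rewrite /subst /diag; apply: eq_bigr => a _.
rewrite /taylor !serCM; congr (_ * _).
case: a => -[|a] //= ak; apply: (@eq_taylor_sum_upto _ _ _ _ a.+1) => j m mk.
by apply: H; rewrite (leq_ltn_trans mk) //; lia.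
Qed.

Lemma ser_map_subst (K L : comNzRingType) (ev : {rmorphism A -> K})
    (h : {rmorphism K -> L}) wt f :
  ser_map h (subst ev wt f) = subst (h \o ev) (fun j => ser_map h (wt j)) f.
Proof.
have T n g : ser_map h (taylor_sum ev wt n g) =
    taylor_sum (h \o ev) (fun j => ser_map h (wt j)) n g.
  elim: n g => [|n ih] g /=.
    by apply/serP => -[|k] //=; rewrite /ser_map /= rmorph0.
  by rewrite rmorph_sum; apply: eq_bigr => i _; rewrite rmorphM /= ih.
apply/serP => n; rewrite /ser_map /subst /diag rmorph_sum; apply: eq_bigr => a _.
rewrite /taylor !serCM rmorphM /=; congr (_ * _).
by have /(congr1 (fun F => F (n - a)%N)) := T a f.
Qed.

End Taylor.

(** * Coordinates and partial derivatives on the cotangent space *)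

Section LinearForms.
Local Open Scope classical_set_scope.
Context {R : realType} {V : normedModType R}.

Lemma is_derive_linear_form (l : V -> R) z v :
  (forall h, l (h *: v + z) = h * l v + l z) -> is_derive z v l (l v).
Proof.
move=> ll; have H : \forall h \near 0^',
    h^-1 *: ((l \o shift z) (h *: v) - l z) = l v.
  near=> h; rewrite /= ll addrK /GRing.scale /= mulKf //.
  by near: h; exact: nbhs_dnbhs_neq.
split; first exact: is_cvg_near_cst H.
exact: lim_near_cst H.
Unshelve. all: by end_near. Qed.

Lemma smooth_linear_form (l : V -> R) : continuous l ->
  (forall h v z, l (h *: v + z) = h * l v + l z) -> smooth l.
Proof.
move=> cl ll; apply: smooth_affine => // v; exists (l v) => z.
exact: is_derive_linear_form.
Qed.

End LinearForms.

Section SmoothFunctions.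
Context {R : realType} {d : nat}.
Local Notation T := (@cotangent R d).
Local Notation A := (smoothfun R d).
Implicit Types (f g : A) (z v : T).

Lemma smoothfunP f g : (forall z, f z = g z) -> f = g.
Proof. by move=> fg; apply/val_inj/funext. Qed.

Lemma smoothfun_smooth f : smooth f.
Proof. by apply/asboolP; exact: smoothfun_valP. Qed.

Definition mk_smoothfun (f : T -> R) (sf : smooth f) : A := SmoothFun (asboolT sf).

Lemma smoothfunD f g z : (f + g) z = f z + g z. Proof. by []. Qed.
Lemma smoothfunN f z : (- f) z = - f z. Proof. by []. Qed.
Lemma smoothfunM f g z : (f * g) z = f z * g z. Proof. by []. Qed.

Definition smoothfun_eval z : A -> R := fun f => f z.
Lemma smoothfun_eval_zmod z : zmod_morphism (smoothfun_eval z). Proof. by []. Qed.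
Lemma smoothfun_eval_monoid z : monoid_morphism (smoothfun_eval z). Proof. by []. Qed.
HB.instance Definition _ z :=
  GRing.isZmodMorphism.Build A R (smoothfun_eval z) (smoothfun_eval_zmod z).
HB.instance Definition _ z :=
  GRing.isMonoidMorphism.Build A R (smoothfun_eval z) (smoothfun_eval_monoid z).

Lemma smoothfun_sum (I : Type) (r : seq I) (P : pred I) (F : I -> A) z :
  (\sum_(i <- r | P i) F i) z = \sum_(i <- r | P i) F i z.
Proof. exact: (rmorph_sum (smoothfun_eval z)). Qed.

Lemma smoothfun_nat n z : (n%:R : A) z = n%:R.
Proof. exact: (rmorph_nat (smoothfun_eval z)). Qed.

Definition scst (c : R) : A := mk_smoothfun (smooth_cst c).

Definition sderive v f : A := mk_smoothfun (smooth_derive v (smoothfun_smooth f)).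

Lemma sderive_derivation v : derivation (sderive v).
Proof.
split=> f g; apply: smoothfunP => z.
  by apply: deriveD; exact: smooth_derivable (smoothfun_smooth _).
apply: etrans (deriveM _ _) _; try exact: smooth_derivable (smoothfun_smooth _).
by rewrite smoothfunD !smoothfunM addrC [g z *: _]mulrC.
Qed.

Lemma sderiveC v w f : sderive v (sderive w f) = sderive w (sderive v f).
Proof.
by apply: val_inj; exact: (smooth_derive_comm w v (smoothfun_smooth f)).
Qed.

Definition sdx (i : 'I_d) : A -> A := sderive (basis_vec i, 0).
Definition sdp (i : 'I_d) : A -> A := sderive (0, basis_vec i).

Definition invfact (n : nat) : A := scst (n`!%:R^-1).

Lemma invfactP n : n`!%:R * invfact n = 1.
Proof.
apply: smoothfunP => z; rewrite smoothfunM smoothfun_nat /= mulfV //.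
Qed.

Definition coord_p (i : 'I_d) : T -> R := fun z => z.2 0 i.

Lemma coord_x_linear i h v z : coord_x i (h *: v + z) = h * coord_x i v + coord_x i z.
Proof. by rewrite /coord_x !mxE. Qed.

Lemma coord_p_linear i h v z : coord_p i (h *: v + z) = h * coord_p i v + coord_p i z.
Proof. by rewrite /coord_p !mxE. Qed.

Lemma coord_x_smooth i : smooth (coord_x i : T -> R).
Proof.
apply: smooth_linear_form => [z|]; last exact: coord_x_linear.
by apply: (@continuous_comp _ _ _ fst (fun x : 'rV[R]_d => x 0 i));
  [exact: cvg_fst|exact: coord_continuous].
Qed.

Lemma coord_p_smooth i : smooth (coord_p i : T -> R).
Proof.
apply: smooth_linear_form => [z|]; last exact: coord_p_linear.
by apply: (@continuous_comp _ _ _ snd (fun x : 'rV[R]_d => x 0 i));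
  [exact: cvg_snd|exact: coord_continuous].
Qed.

Definition sx i : A := mk_smoothfun (coord_x_smooth i).
Definition sp i : A := mk_smoothfun (coord_p_smooth i).

Lemma basis_vecE (i j : 'I_d) : (basis_vec i 0 j : R) = (i == j)%:R.
Proof. by rewrite /basis_vec mxE eqxx eq_sym. Qed.

Lemma sderive_sx v i : sderive v (sx i) = scst (coord_x i v).
Proof.
apply: smoothfunP => z; have [_] := is_derive_linear_form (fun h => coord_x_linear i h v z).
by [].
Qed.

Lemma sderive_sp v i : sderive v (sp i) = scst (coord_p i v).
Proof.
apply: smoothfunP => z; have [_] := is_derive_linear_form (fun h => coord_p_linear i h v z).
by [].
Qed.

Lemma scst_nat n : scst n%:R = n%:R.
Proof. by apply: smoothfunP => z; rewrite smoothfun_nat. Qed.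

Lemma sdx_sx i j : sdx i (sx j) = (i == j)%:R.
Proof. by rewrite /sdx sderive_sx -scst_nat /coord_x /= basis_vecE. Qed.
Lemma sdp_sx i j : sdp i (sx j) = 0.
Proof. by rewrite /sdp sderive_sx /coord_x /= mxE -[0]/(0%:R) scst_nat. Qed.
Lemma sdx_sp i j : sdx i (sp j) = 0.
Proof. by rewrite /sdx sderive_sp /coord_p /= mxE -[0]/(0%:R) scst_nat. Qed.
Lemma sdp_sp i j : sdp i (sp j) = (i == j)%:R.
Proof. by rewrite /sdp sderive_sp -scst_nat /coord_p /= basis_vecE. Qed.

Lemma derive_fst (f : 'rV[R]_d -> R) v :
  'D_v (fun z : T => f z.1) = (fun z => 'D_(v.1) f z.1).
Proof. by []. Qed.

Lemma smooth_fst (f : 'rV[R]_d -> R) : smooth f -> smooth (fun z : T => f z.1).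
Proof.
move=> sf; apply/smoothP => n; move/smoothP: sf => /(_ n).
have cfst (g : 'rV[R]_d -> R) : continuous g -> continuous (fun z : T => g z.1).
  by move=> cg z; apply: (@continuous_comp _ _ _ fst g); [exact: cvg_fst|exact: cg].
elim: n f => [|n ih] f [cf df Hf]; first by split=> [|v z|//]; [exact: cfst|exact: df].
by split=> [|v z|v]; [exact: cfst|exact: df|exact: ih (Hf v.1)].
Qed.

Lemma derive_fst_p (f : 'rV[R]_d -> R) (i : 'I_d) :
  'D_((0, basis_vec i) : T) (fun z : T => f z.1) = fun=> 0.
Proof. by rewrite derive_fst; apply/funext => z; exact: derive0. Qed.

End SmoothFunctions.

(** * Solutions of the Karasev equation are symplectic *)

(** The determinant of A is a unit, so the adjugate yields a left inverse, which must be B.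
    Differentiating the Karasev equation gives an inverse on one side only. *)
Lemma mulmx_eq1C (K : comNzRingType) n (A B : 'M[K]_n) :
  A *m B = 1%:M -> B *m A = 1%:M.
Proof.
move=> AB; have detAB : \det B * \det A = 1 by rewrite mulrC -det_mulmx AB det1.
have LA : (\det B *: \adj A) *m A = 1%:M.
  by rewrite -scalemxAl mul_adj_mx scale_scalar_mx detAB.
suff <- : \det B *: \adj A = B by [].
by rewrite -[LHS]mulmx1 -AB mulmxA LA mul1mx.
Qed.

Section PoissonAlgebra.
Variables (A : comNzRingType) (d : nat) (dx dp : 'I_d -> A -> A).
Variables (x p : 'I_d -> A) (pi : 'I_d -> 'I_d -> A) (invfact : nat -> A).
Hypotheses (Hdx : forall i, derivation (dx i)) (Hdp : forall i, derivation (dp i)).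
Hypotheses (dxC : forall i j f, dx i (dx j f) = dx j (dx i f))
  (dpxC : forall i j f, dp i (dx j f) = dx j (dp i f)).
Hypotheses (dx_x : forall i j, dx i (x j) = (i == j)%:R)
  (dp_x : forall i j, dp i (x j) = 0)
  (dx_p : forall i j, dx i (p j) = 0)
  (dp_p : forall i j, dp i (p j) = (i == j)%:R).
Hypothesis invfactP : forall n, n`!%:R * invfact n = 1.
Hypotheses (dp_pi : forall k i j, dp k (pi i j) = 0)
  (pi_anti : forall i j, pi i j = - pi j i)
  (pi_jacobi : forall i j k, \sum_l (pi i l * dx l (pi j k) +
     pi j l * dx l (pi k i) + pi k l * dx l (pi i j)) = 0).

Definition vec (j : 'I_d) : A := - \sum_i pi i j * p i.
Definition lie (f : A) : A := \sum_j vec j * dx j f.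
Definition pbracket (f g : A) : A := \sum_k \sum_l pi k l * (dx k f * dx l g).

Lemma lie_derivation : derivation lie.
Proof.
split=> f g; rewrite /lie.
  by rewrite -big_split; apply: eq_bigr => j _; rewrite (derD (Hdx j)) mulrDr.
rewrite mulr_suml mulr_sumr -big_split; apply: eq_bigr => j _ /=.
by rewrite (derM (Hdx j)); ring.
Qed.

Lemma pbracketC f g : pbracket f g = - pbracket g f.
Proof.
rewrite /pbracket -sumrN exchange_big; apply: eq_bigr => k _.
rewrite -sumrN; apply: eq_bigr => l _.
by rewrite pi_anti; ring.
Qed.

Lemma pbracketZl c f g : (forall i, dx i c = 0) ->
  pbracket (c * f) g = c * pbracket f g.
Proof.
move=> dc; rewrite /pbracket mulr_sumr; apply: eq_bigr => k _; rewrite mulr_sumr.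
by apply: eq_bigr => l _; rewrite (derMl (Hdx k)) //; ring.
Qed.

Lemma pbracketZr c f g : (forall i, dx i c = 0) ->
  pbracket f (c * g) = c * pbracket f g.
Proof. by move=> dc; rewrite pbracketC pbracketZl // -mulrN -pbracketC. Qed.

Lemma dx_lie k f : dx k (lie f) = lie (dx k f) + \sum_m dx k (vec m) * dx m f.
Proof.
rewrite /lie (der_sum (Hdx k)) -big_split; apply: eq_bigr => m _ /=.
by rewrite (derM (Hdx k)) dxC addrC.
Qed.

(** Invariance of pi along Vbar. For fixed p this field is Hamiltonian, f being sent to {- p_i x^i,
    f}, so the claim is the Jacobi identity contracted with p_i. *)
Lemma lie_pi k l : lie (pi k l) =
  \sum_m (pi m l * dx m (vec k) + pi k m * dx m (vec l)).
Proof.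
have dvec m j : dx m (vec j) = - \sum_i dx m (pi i j) * p i.
  rewrite /vec (derN (Hdx m)) (der_sum (Hdx m)); congr (- _).
  by apply: eq_bigr => i _; rewrite (derM (Hdx m)) dx_p mulr0 addr0.
apply/eqP; rewrite -subr_eq0 -oppr_eq0; apply/eqP.
transitivity (\sum_i p i * \sum_m (pi i m * dx m (pi k l) +
     pi k m * dx m (pi l i) + pi l m * dx m (pi i k))); last first.
  by apply: big1 => i _; rewrite pi_jacobi mulr0.
under [RHS]eq_bigr => i _ do rewrite mulr_sumr.
rewrite exchange_big /lie /= -sumrB -sumrN; apply: eq_bigr => m _.
rewrite !dvec /vec !mulrN mulNr !mulr_sumr mulr_suml.
rewrite opprB opprK -opprD -!big_split /= -sumrN -big_split /=.
apply: eq_bigr => i _.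
by rewrite (pi_anti m l) (pi_anti l i) (derN (Hdx m)); ring.
Qed.

Lemma lie_pbracket f g :
  lie (pbracket f g) = pbracket (lie f) g + pbracket f (lie g).
Proof.
have LD := lie_derivation.
rewrite /pbracket (der_sum LD).
under eq_bigr => k _ do rewrite (der_sum LD).
transitivity (\sum_k \sum_l (lie (pi k l) * (dx k f * dx l g)) +
  \sum_k \sum_l (pi k l * (lie (dx k f) * dx l g + dx k f * lie (dx l g)))).
  rewrite -big_split; apply: eq_bigr => k _; rewrite -big_split.
  by apply: eq_bigr => l _; rewrite !(derM LD).
rewrite -[in RHS]big_split /=.
under [RHS]eq_bigr => k _ do rewrite -big_split /=.
under [RHS]eq_bigr => k _ do under eq_bigr => l _ do rewrite !dx_lie.
rewrite [RHS](eq_bigr (fun k => \sum_l pi k l *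
     (lie (dx k f) * dx l g + dx k f * lie (dx l g)) +
  \sum_l pi k l * ((\sum_m dx k (vec m) * dx m f) * dx l g +
                   dx k f * \sum_m dx l (vec m) * dx m g))); last first.
  by move=> k _; rewrite -[RHS]big_split; apply: eq_bigr => l _ /=; ring.
(* The terms with [lie] of a partial derivative agree. What remains is [lie] of pi on the left
   against the commutators of [dx] and [lie] on the right, matched by [lie_pi]. *)
rewrite [RHS]big_split [LHS]addrC; congr (_ + _).
under eq_bigr => k _ do under eq_bigr => l _ do rewrite lie_pi.
under [RHS]eq_bigr => k _ do under eq_bigr => l _ do rewrite mulrDr.
under [RHS]eq_bigr => k _ do rewrite big_split /=.
rewrite [RHS]big_split /=.
transitivity (\sum_k \sum_l \sum_m (pi m l * dx m (vec k)) * (dx k f * dx l g) +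
  \sum_k \sum_l \sum_m (pi k m * dx m (vec l)) * (dx k f * dx l g)).
  rewrite -big_split; apply: eq_bigr => k _; rewrite -big_split /=.
  apply: eq_bigr => l _; rewrite -big_split /= mulr_suml.
  by apply: eq_bigr => m _; rewrite mulrDl.
congr (_ + _).
  under [RHS]eq_bigr => k _ do under eq_bigr => l _ do
    rewrite mulr_suml mulr_sumr.
  rewrite [RHS]exchange_big [LHS]exchange_big; apply: eq_bigr => l _ /=.
  rewrite exchange_big; apply: eq_bigr => k _; apply: eq_bigr => m _ /=.
  by ring.
apply: eq_bigr => k _; under [RHS]eq_bigr => l _ do rewrite !mulr_sumr.
rewrite exchange_big; apply: eq_bigr => l _; apply: eq_bigr => m _ /=.
by ring.
Qed.

Lemma dp_lie j f : dp j (lie f) = lie (dp j f) - pbracket (x j) f.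
Proof.
rewrite /lie (der_sum (Hdp j)).
have -> : pbracket (x j) f = \sum_l pi j l * dx l f.
  rewrite /pbracket (bigD1 j) //= [X in _ + X]big1 ?addr0 => [|k kj].
    by apply: eq_bigr => l _; rewrite dx_x eqxx mul1r.
  by apply: big1 => l _; rewrite dx_x (negbTE kj) mul0r mulr0.
rewrite -sumrB; apply: eq_bigr => m _.
rewrite (derM (Hdp j)) dpxC addrC; congr (_ + _).
rewrite /vec (derN (Hdp j)) (der_sum (Hdp j)) mulNr; congr (- (_ * _)).
rewrite (bigD1 j) //= big1 ?addr0 => [|i ij].
  by rewrite (derM (Hdp j)) dp_pi dp_p eqxx mul0r add0r mulr1.
by rewrite (derM (Hdp j)) dp_pi dp_p eq_sym (negbTE ij) mul0r add0r mulr0.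
Qed.

(** Each of the n operators L contributes one commutator. If a operators stand to its left, Leibniz
    gives the coefficient C(a, m), and summing over a < n gives C(n, m + 1). *)
Lemma dp_iter_lie i j n : dp j (iter n lie (x i)) =
  \sum_(m < n) pbracket (iter (n.-1 - m) lie (x i)) (iter m lie (x j))
                 *+ 'C(n, m.+1).
Proof.
have LD := lie_derivation.
pose b n m := pbracket (iter n lie (x i)) (iter m lie (x j)).
elim: n => [|n ih]; first by rewrite big_ord0 /= dp_x.
rewrite iterS dp_lie ih (der_sum LD) pbracketC opprK.
transitivity (\sum_(m < n) b (n - m)%N m *+ 'C(n, m.+1) +
  \sum_(m < n) b (n - m.+1)%N m.+1 *+ 'C(n, m.+1) + b n 0%N).
  congr (_ + _); rewrite -big_split; apply: eq_bigr => m _ /=.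
  rewrite (derMn LD) lie_pbracket -mulrnDl; have mn := ltn_ord m.
  have -> : (n - m)%N = (n.-1 - m).+1 by lia.
  by have -> : (n - m.+1)%N = (n.-1 - m)%N by lia.
transitivity (\sum_(m < n.+1) b (n - m)%N m *+ 'C(n, m.+1) +
   \sum_(m < n.+1) b (n - m)%N m *+ 'C(n, m)); last first.
  by rewrite -big_split; apply: eq_bigr => m _ /=; rewrite binS mulrnDr.
rewrite big_ord_recr /= bin_small // mulr0n addr0 -addrA; congr (_ + _).
by rewrite [RHS]big_ord_recl bin0 subn0 addrC.
Qed.

Definition phi_ser (i : 'I_d) : ser A :=
  fun n => invfact n.+1 * iter n lie (x i).

Lemma dx_invfact k n : dx k (invfact n) = 0.
Proof. exact: (der_natV (Hdx k) (invfactP n)). Qed.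

Lemma dp_invfact k n : dp k (invfact n) = 0.
Proof. exact: (der_natV (Hdp k) (invfactP n)). Qed.

Lemma phi_ser_pbracket i j :
  ser_map (dp j) (phi_ser i) - ser_map (dp i) (phi_ser j) =
  serX A * \sum_k \sum_l serC (pi k l) *
    (ser_map (dx k) (phi_ser i) * ser_map (dx l) (phi_ser j)).
Proof.
pose b i j n m := pbracket (iter n lie (x i)) (iter m lie (x j)).
have D i' j' n : ser_map (dp j') (phi_ser i') n =
    \sum_(m < n) invfact n.+1 * (b i' j' (n.-1 - m)%N m *+ 'C(n, m.+1)).
  rewrite ser_mapE /phi_ser (derMl (Hdp j')) ?dp_invfact //.
  by rewrite dp_iter_lie mulr_sumr.
apply/serP => n; rewrite serXM serD serN !D.
case: n => [|n]; first by rewrite !big_ord0 subr0.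
transitivity (\sum_(m < n.+1) pbracket (phi_ser i (n - m)%N) (phi_ser j m)).
  rewrite [X in _ - X](reindex_inj rev_ord_inj) -sumrB; apply: eq_bigr => m _ /=.
  have mn : (m <= n)%N by rewrite -ltnS.
  rewrite /phi_ser pbracketZl; last by move=> k; exact: dx_invfact.
  rewrite pbracketZr; last by move=> k; exact: dx_invfact.
  rewrite -/(b _ _ _ _) subSS (_ : b j i _ _ = - b i j (n - m)%N m); last first.
    by rewrite /b pbracketC subKn.
  (* The two derivatives contribute C(n+1, m+1) and, after reversal, C(n+1, m). By Pascal's rule
     these add up to C(n+2, m+1), which 1/(n+2)! splits into the factors 1/(n+1-m)! and 1/(m+1)! of
     the two series. *)
  have -> : 'C(n.+1, (n - m).+1) = 'C(n.+1, m).
    by rewrite -subSn // bin_sub // leqW.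
  rewrite mulNrn mulrN opprK -mulrDr -mulrnDr -binS -mulr_natl mulrA.
  rewrite invfactM //; last by rewrite ltnW.
  by rewrite subSS subSn // [RHS]mulrCA mulrA.
rewrite ser_sum; under [RHS]eq_bigr => k _ do rewrite ser_sum.
rewrite (eq_bigr (fun k => \sum_l \sum_(m < n.+1) pi k l *
  (dx k (phi_ser i m) * dx l (phi_ser j (n - m)%N)))) => [|k _]; last first.
  by apply: eq_bigr => l _; rewrite serCM serM mulr_sumr.
rewrite (reindex_inj rev_ord_inj) /=.
under [RHS]eq_bigr => k _ do rewrite exchange_big.
rewrite [RHS]exchange_big; apply: eq_bigr => m _ /=.
by rewrite subSS subKn // -ltnS.
Qed.

Section Symplectic.
Variable wt : 'I_d -> ser A.
Let C := @subst_ser A d dx invfact Hdx invfactP A idfun wt.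

Definition shifted (i : 'I_d) : ser A := serC (x i) + serX A * wt i.

Hypothesis karasev : forall i, C (phi_ser i) = serC (x i).

Lemma karasev_symplectic i j :
  \sum_k (ser_map (dx k) (shifted i) * ser_map (dp k) (shifted j) -
          ser_map (dp k) (shifted i) * ser_map (dx k) (shifted j)) =
  serX A * C (serC (pi i j)).
Proof.
(* M and B are the Jacobians of phi in x and in p, taken at the realization; N and P are those of
   the realization itself. *)
pose M : 'M[ser A]_d := \matrix_(i, j) C (ser_map (dx j) (phi_ser i)).
pose B : 'M[ser A]_d := \matrix_(i, j) C (ser_map (dp j) (phi_ser i)).
pose N : 'M[ser A]_d := \matrix_(i, j) ser_map (dx j) (shifted i).
pose P : 'M[ser A]_d := \matrix_(i, j) ser_map (dp j) (shifted i).
pose Q : 'M[ser A]_d := \matrix_(i, j) C (serC (pi i j)).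
have dser (D : A -> A) (HD : derivation D) i' : ser_map D (shifted i') =
    serC (D (x i')) + serX A * ser_map D (wt i').
  have HD' := derivation_ser_map HD.
  rewrite /shifted (derD HD') (derMl HD'); first by rewrite ser_map_serC.
  by apply/serP => n; rewrite ser_mapE /serX (der_nat HD).
(* The Karasev equation differentiated by D: with [dx] it yields M N = 1, with [dp] it yields M P =
   - B. *)
have chain (D : A -> A) (HD : derivation D) (HDC : forall i f, D (dx i f) = dx i (D f)) i' :
    serC (D (x i')) = serX A * (\sum_j ser_map D (wt j) *
      C (ser_map (dx j) (phi_ser i'))) + C (ser_map D (phi_ser i')).
  by rewrite -(@subst_ser_chain A d dx invfact Hdx dxC invfactP A idfun wt D D HD (fun=> erefl) HDC)
    -/(C _) karasev ser_map_serC.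
have MN : M *m N = 1%:M.
  apply/matrixP => i' k; rewrite !mxE.
  have := chain _ (Hdx k) (fun i f => dxC k i f) i'.
  rewrite dx_x rmorph_nat eq_sym => ->.
  under eq_bigr => m _ do rewrite !mxE (dser _ (Hdx k)) dx_x rmorph_nat mulrDr.
  rewrite big_split addrC mulr_sumr; congr (_ + _) => /=; last first.
    by apply: eq_bigr => m _; rewrite mulrCA [X in _ * X]mulrC.
  rewrite (bigD1 k) //= eqxx mulr1 big1 ?addr0 // => m mk.
  by rewrite eq_sym (negbTE mk) mulr0.
have MP : M *m P = - B.
  apply/matrixP => i' k; rewrite !mxE; apply/eqP; rewrite -addr_eq0; apply/eqP.
  have E := chain _ (Hdp k) (fun i f => dpxC k i f) i'.
  rewrite dp_x rmorph0 in E; rewrite [RHS]E; congr (_ + _); rewrite mulr_sumr.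
  apply: eq_bigr => m _; rewrite !mxE (dser _ (Hdp k)) dp_x rmorph0 add0r.
  by rewrite mulrCA [X in _ * X]mulrC.
have NM := mulmx_eq1C MN.
have PE : P = - (N *m B) by rewrite -mulmxN -MP mulmxA NM mul1mx.
have BB : B - B^T = serX A *: (M *m Q *m M^T).
  apply/matrixP => i' j'; rewrite !mxE -rmorphB phi_ser_pbracket rmorphM.
  congr (_ * _); first exact: subst_serX.
  rewrite rmorph_sum; under eq_bigr => k _ do rewrite rmorph_sum.
  rewrite exchange_big; apply: eq_bigr => l _ /=.
  rewrite !mxE mulr_suml; apply: eq_bigr => k _.
  by rewrite !mxE !rmorphM /=; ring.
(* This is the bracket. Inserting P = - N B turns it into N (B - B^T) N^T, and [BB] with N M = 1
   leaves eps Q. *)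
transitivity ((N *m P^T - P *m N^T) i j).
  rewrite !mxE -sumrB; apply: eq_bigr => k _; rewrite !mxE.
  by [].
rewrite PE linearN /= trmx_mul mulmxN mulNmx opprK addrC mulmxA.
rewrite -!mulmxA -mulmxBr -mulmxBl BB.
rewrite -scalemxAl -scalemxAr -!mulmxA -trmx_mul NM trmx1 mulmx1.
by rewrite mulmxA NM mul1mx !mxE.
Qed.
End Symplectic.
End PoissonAlgebra.

Lemma big_tuple_cons (M : nmodType) (T : finType) n (F : n.+1.-tuple T -> M) :
  \sum_t F t = \sum_x \sum_(t : n.-tuple T) F [tuple of x :: t].
Proof.
rewrite pair_big /= (reindex (fun q : T * n.-tuple T => [tuple of q.1 :: q.2])) //.
exists (fun t : n.+1.-tuple T => (thead t, [tuple of behead t])) => [[x t] _|t _].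
  by rewrite /= theadE; congr pair; apply: val_inj.
by rewrite -tuple_eta.
Qed.

Lemma big_tuple0 (M : nmodType) (T : finType) (F : 0.-tuple T -> M) :
  \sum_t F t = F [tuple].
Proof. by rewrite (big_pred1 [tuple]) // => t; apply/esym/eqP; exact: tuple0. Qed.

(** * Formal composition as a ring-theoretic substitution *)

Section Substitution.
Context {R : realType} {d : nat}.
Local Notation T := (@cotangent R d).
Local Notation A := (smoothfun R d).
Implicit Types (f g : A) (z v : T) (s : 'I_d -> @fseries R d).

Let Hdx (i : 'I_d) : derivation (sdx i : A -> A) := sderive_derivation _.

Definition sdxs (I : seq 'I_d) f : A := foldr sdx f I.

Lemma sdxsE (I : seq 'I_d) f : sdxs I f = d_xs I f :> (T -> R).
Proof. by elim: I => //= i I; rewrite /d_xs /= => <-. Qed.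

Lemma sdxs_sdx (I : seq 'I_d) i f : sdxs I (sdx i f) = sdx i (sdxs I f).
Proof. by elim: I => //= j I ->; rewrite /sdx sderiveC. Qed.

Definition tail_at s z : 'I_d -> ser R := fun i n => s i n.+1 z.

Lemma fmul_prod_at (I : seq 'I_d) s z m :
  (\big[@fmul R d/fconst (fun=> 1)]_(i <- I) (fun k => s i k.+1)) m z =
  (\prod_(i <- I) tail_at s z i) m.
Proof.
elim: I m => [|i I ih] m; first by rewrite !big_nil ser1; case: m.
by rewrite !big_cons /fmul serM; apply: eq_bigr => a _; rewrite ih.
Qed.

Lemma taylor_sumE n f s z m :
  taylor_sum sdx (smoothfun_eval z) (tail_at s z) n f m =
  \sum_(I : n.-tuple 'I_d) (\prod_(i <- I) tail_at s z i) m * d_xs I f z.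
Proof.
elim: n f m => [|n ih] f m /=.
  by rewrite big_tuple0 big_nil ser1; case: m => [|m]; rewrite /= ?mul1r ?mul0r.
rewrite big_tuple_cons ser_sum; apply: eq_bigr => i _.
rewrite serM; under eq_bigr => a _ do rewrite ih mulr_sumr.
rewrite exchange_big; apply: eq_bigr => I _ /=.
rewrite big_cons serM mulr_suml; apply: eq_bigr => a _.
rewrite mulrA; congr (_ * _); transitivity (sdxs I (sdx i f) z).
  by rewrite sdxsE.
by rewrite sdxs_sdx -[RHS]/(d_xs (i :: I) f z) -sdxsE.
Qed.

(** The definition expands around (w_0(z), z.2). The hypothesis at order 0 makes this point z, so
    that evaluation at z can serve as the base morphism. *)
Lemma fcomp0_subst f s z k : (forall i, s i 0%N z = coord_x i z) ->
  fcomp0 f s k z = subst sdx invfact (smoothfun_eval z) (tail_at s z) f k.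
Proof.
move=> s0; rewrite /fcomp0 /subst /diag; apply: eq_bigr => n _.
rewrite /taylor serCM taylor_sumE; congr (_ * _); apply: eq_bigr => I _.
rewrite fmul_prod_at; congr (_ * d_xs _ _ _).
case: z s0 => y q s0; congr (_, _); apply/rowP => i; rewrite mxE s0 //.
Qed.

Lemma eq_subst_ev (K : comNzRingType) (ev ev' : {rmorphism A -> K}) wt f :
  ev =1 ev' -> subst sdx invfact ev wt f = subst sdx invfact ev' wt f.
Proof.
move=> E; have T n g : taylor_sum sdx ev wt n g = taylor_sum sdx ev' wt n g.
  elim: n g => [|n ih] g /=; first by rewrite E.
  by apply: eq_bigr => i _; rewrite ih.
by apply/serP => k; apply: eq_bigr => a _; rewrite /taylor T E.
Qed.

(** Differentiating a composition requires series over the ring of functions, while the statement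
    composes point by point; this passes between the two. *)
Lemma subst_eval wt f k z : subst sdx invfact idfun wt f k z =
  subst sdx invfact (smoothfun_eval z) (fun j n => wt j n z) f k.
Proof.
rewrite -(@eq_subst_ev R (smoothfun_eval z \o idfun) (smoothfun_eval z)) //.
exact: (congr1 (fun F => F k)
  (ser_map_subst sdx invfact idfun (smoothfun_eval z) wt f)).
Qed.

End Substitution.

(** * Symplecticity and uniqueness for a given Poisson structure *)

Section Realization.
Context {R : realType} {d : nat} (pi : 'I_d -> 'I_d -> 'rV[R]_d -> R).
Hypothesis Hpi : poisson_structure pi.
Local Notation T := (@cotangent R d).
Local Notation A := (smoothfun R d).

Lemma pi_smooth i j : smooth (pi i j). Proof. by case: Hpi. Qed.

Definition spi (i j : 'I_d) : A := mk_smoothfun (smooth_fst (pi_smooth i j)).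

Lemma sdp_spi k i j : sdp k (spi i j) = 0.
Proof. by apply: smoothfunP => z; exact: (congr1 (fun f => f z) (derive_fst_p _ k)). Qed.

Lemma spi_anti i j : spi i j = - spi j i.
Proof. by case: Hpi => _ H _; apply: smoothfunP => z; rewrite smoothfunN /= H. Qed.

Lemma spi_jacobi i j k : \sum_l (spi i l * sdx l (spi j k) +
  spi j l * sdx l (spi k i) + spi k l * sdx l (spi i j)) = 0.
Proof.
case: Hpi => _ _ H; apply: smoothfunP => z; rewrite smoothfun_sum.
exact: etrans (H i j k z.1).
Qed.

Local Notation X := (vec (sp (R := R)) spi).

Lemma vecE j : X j = Vbar pi j :> (T -> R).
Proof.
apply/funext => z; rewrite /vec smoothfunN smoothfun_sum; congr (- _).
Qed.

Lemma lieE (f : A) : lie sdx sp spi f = L_Vbar pi f :> (T -> R).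
Proof.
apply/funext => z; rewrite /lie smoothfun_sum /L_Vbar exchange_big -sumrN.
apply: eq_bigr => j _; rewrite smoothfunM vecE /Vbar mulNr mulr_suml.
by congr (- _).
Qed.

Lemma phi_serE i n : phi_ser sdx sx sp spi invfact i n = phi pi i n :> (T -> R).
Proof.
apply/funext => z; rewrite /phi_ser /phi smoothfunM; congr (_ * _).
suff -> : smoothfun_val (iter n (lie sdx sp spi) (sx i)) =
  iter n (L_Vbar pi) (coord_x i) by [].
by elim: n => //= n <-; rewrite lieE.
Qed.

Let Hdx (i : 'I_d) : derivation (sdx i : A -> A) := sderive_derivation _.
Let Hdp (i : 'I_d) : derivation (sdp i : A -> A) := sderive_derivation _.

Section NearIdentity.
Variable s : 'I_d -> @fseries R d.
Hypothesis Hs : near_identity s.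

Definition bundle i : ser A := fun k => mk_smoothfun ((Hs i).1 k).
Let wt i : ser A := fun k => bundle i k.+1.

Lemma bundle_shifted i : bundle i = shifted sx wt i.
Proof.
apply/serP => -[|n]; rewrite /shifted serD serXM ?addr0 ?add0r //.
by apply: smoothfunP => z; exact: (Hs i).2.
Qed.

Lemma fcomp0_bundle (f : A) k z :
  fcomp0 f s k z = subst sdx invfact idfun wt f k z.
Proof. by rewrite subst_eval fcomp0_subst // => i; case: (Hs i). Qed.

Lemma fcomp_bundle (F : ser A) k z :
  fcomp (fun n => F n) s k z = subst_ser Hdx invfactP idfun wt F k z.
Proof.
rewrite /fcomp /subst_ser /diag smoothfun_sum; apply: eq_bigr => m _.
exact: fcomp0_bundle.
Qed.

Lemma karasev_equation_symplectic : karasev_equation pi s ->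
  formal_symplectic_realization pi s.
Proof.
move=> ke; split=> // i j k z.
have kar i' : subst_ser Hdx invfactP idfun wt (phi_ser sdx sx sp spi invfact i') =
    serC (sx i').
  apply/serP => n; apply: smoothfunP => y; rewrite -fcomp_bundle.
  have := ke i' n y; rewrite (_ : (fun n : nat => _) = phi pi i').
    by move=> ->; case: n.
  by apply/funext => m; exact: phi_serE.
have := @karasev_symplectic A d sdx sdp sx sp spi invfact Hdx Hdp
  (fun i j f => sderiveC _ _ f) (fun i j f => sderiveC _ _ f) sdx_sx sdp_sx
  sdx_sp sdp_sp invfactP sdp_spi spi_anti spi_jacobi wt kar i j.
rewrite -!bundle_shifted subst_serC => /(congr1 (fun F : ser A => F k z)).
rewrite serXM ser_sum smoothfun_sum => E.
transitivity ((if k is m.+1 then subst sdx invfact idfun wt (spi i j) m else 0) z);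
  last by case: k {E} => // k; rewrite /= -fcomp0_bundle.
rewrite -{}E /fbracket /bracket exchange_big; apply: eq_bigr => l _.
by rewrite serD serN !serM smoothfunD smoothfunN !smoothfun_sum -sumrB.
Qed.

End NearIdentity.

(** As phi starts with x, order k of the equation contains s_k once, and the terms of positive order
    of phi involve only orders of s below k. *)
Lemma karasev_unique s s' : near_identity s -> near_identity s' ->
  karasev_equation pi s -> karasev_equation pi s' ->
  forall i k z, s' i k z = s i k z.
Proof.
move=> Hs Hs' ks ks' i k z; elim/ltn_ind: k i => k ih i.
have E s0 : near_identity s0 -> karasev_equation pi s0 ->
    s0 i k z = fconst (coord_x i) k z - \sum_(m < k) fcomp0 (phi pi i m.+1) s0 (k - m.+1)%N z.
  move=> H0 k0; rewrite -k0 /fcomp big_ord_recl /=.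
  rewrite addrK subn0 (_ : phi pi i 0%N = sx i); last first.
    by apply/funext => y; rewrite /phi /= invr1 mul1r.
  rewrite fcomp0_subst; last by move=> j; case: (H0 j).
  rewrite (subst_coord Hdx invfactP _ _ (fun l => sdx_sx l i)).
  rewrite serD serXM; case: (k) => [|n]; rewrite ?addr0 ?add0r //.
  by case: (H0 i).
rewrite !E //; congr (_ - _); apply: eq_bigr => m _.
have s0 j : s j 0%N z = coord_x j z by case: (Hs j).
have s'0 j : s' j 0%N z = coord_x j z by case: (Hs' j).
rewrite -phi_serE !fcomp0_subst //.
apply: eq_subst_upto => j n nk; apply: ih.
by have := ltn_ord m; lia.
Qed.

End Realization.

(** * Enumeration of plane trees *)

Lemma nb_vertices_gt0 t : (0 < nb_vertices t)%N. Proof. by case: t. Qed.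

(* Counting the vertices other than the root makes the enumeration of the trees
   with k of them match the coefficients of order k of a composition. *)
Definition rank (t : rtree) : nat := (nb_vertices t).-1.

Lemma rank_Node ts : rank (Node ts) = (size ts + sumn (map rank ts))%N.
Proof.
rewrite /rank /=; elim: ts => //= t ts ->.
by have := nb_vertices_gt0 t; lia.
Qed.

Definition trees_le (k : nat) : seq rtree :=
  fset_set [set t | (nb_vertices t <= k.+1)%N]%classic.

Lemma mem_trees_le k t : (t \in trees_le k) = (rank t <= k)%N.
Proof.
rewrite /trees_le in_fset_set; last exact: finite_rtree_le.
have nk : (nb_vertices t <= k.+1)%N = (rank t <= k)%N.
  by rewrite /rank; have := nb_vertices_gt0 t; case: nb_vertices.
by apply/idP/idP => [/set_mem /=|H]; [rewrite nk|apply/mem_set; rewrite /= nk].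
Qed.

Lemma trees_le_uniq k : uniq (trees_le k). Proof. exact: fset_uniq. Qed.

Definition trees (k : nat) : seq rtree := [seq t <- trees_le k | rank t == k].

Lemma mem_trees k t : (t \in trees k) = (rank t == k).
Proof. by rewrite mem_filter mem_trees_le; case: eqP => // ->; rewrite leqnn. Qed.

Lemma trees_uniq k : uniq (trees k).
Proof. by rewrite filter_uniq ?trees_le_uniq. Qed.

Fixpoint forests (n m : nat) : seq (seq rtree) :=
  if n is n'.+1 then
    [seq t :: ts | t <- trees_le m, ts <- forests n' (m - rank t)]
  else if m == 0%N then [:: [::]] else [::].

Lemma mem_forests n m ts :
  (ts \in forests n m) = (size ts == n) && (sumn (map rank ts) == m).
Proof.
elim: n m ts => [|n ih] m ts /=.
  by case: eqP => [->|/eqP m0]; case: ts => //=; rewrite ?inE // eq_sym (negbTE m0).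
apply/allpairsPdep/andP => [[t [us [tm usf ->]]]|[]].
  move: tm usf; rewrite mem_trees_le ih => tm /andP[/= sz /eqP ->].
  by split=> //; rewrite subnKC.
case: ts => //= t us sz /eqP E; exists t, us; split=> //.
  by rewrite mem_trees_le -E leq_addr.
by rewrite ih -E addKn eqxx andbT.
Qed.

Lemma forests_uniq n m : uniq (forests n m).
Proof.
elim: n m => [|n ih] m /=; first by case: ifP.
apply: allpairs_uniq_dep => //; first exact: trees_le_uniq.
by move=> [t ts] [u us] /= _ _ [-> ->].
Qed.

Section TreeSums.
Variable M : nmodType.

Lemma sum_trees_le m (g : rtree -> M) :
  \sum_(t <- trees_le m) g t = \sum_(a < m.+1) \sum_(t <- trees a) g t.
Proof.
transitivity (\sum_(a < m.+1) \sum_(t <- trees_le m | rank t == a) g t).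
  rewrite (exchange_big_dep predT) //= big_seq [RHS]big_seq.
  apply: eq_bigr => t; rewrite mem_trees_le -ltnS => tm.
  by rewrite (big_pred1 (Ordinal tm)) // => a; rewrite /= -val_eqE /= eq_sym.
apply: eq_bigr => a _; rewrite -big_filter; apply: perm_big; apply: uniq_perm.
- by rewrite filter_uniq ?trees_le_uniq.
- exact: trees_uniq.
move=> t; rewrite mem_trees mem_filter mem_trees_le.
by case: eqP => // ->; rewrite -ltnS ltn_ord.
Qed.

Lemma sum_forestsS n m (g : seq rtree -> M) :
  \sum_(ts <- forests n.+1 m) g ts =
  \sum_(a < m.+1) \sum_(t <- trees a) \sum_(ts <- forests n (m - a)) g (t :: ts).
Proof.
rewrite /= big_allpairs_dep sum_trees_le; apply: eq_bigr => a _.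
rewrite big_seq [RHS]big_seq; apply: eq_bigr => t.
by rewrite mem_trees => /eqP ->.
Qed.

(** Each child counts its own root besides its rank, so n children of a tree of rank k leave k - n
    to be shared among their ranks. *)
Lemma sum_trees k (g : rtree -> M) : \sum_(t <- trees k) g t =
  \sum_(n < k.+1) \sum_(ts <- forests n (k - n)) g (Node ts).
Proof.
rewrite -(big_mkord xpredT (fun n => \sum_(ts <- forests n (k - n)) g (Node ts))).
transitivity (\sum_(t <- [seq Node ts | n <- index_iota 0 k.+1,
    ts <- forests n (k - n)]) g t); last by rewrite big_allpairs_dep.
apply: perm_big; apply: uniq_perm; first exact: trees_uniq.
  apply: allpairs_uniq_dep => [|n _|].
  - exact: iota_uniq.
  - exact: forests_uniq.
  move=> p q /allpairsPdep[n [ts [_ Hts ->]]] /allpairsPdep[n' [us [_ Hus ->]]].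
  move=> /= [E]; move: Hts Hus; rewrite !mem_forests E.
  by move=> /andP[/eqP <- _] /andP[/eqP <- _].
case=> ts; rewrite mem_trees rank_Node; apply/eqP/allpairsPdep => [E|].
  exists (size ts), ts; rewrite mem_forests eqxx mem_index_iota; split=> //=.
    by rewrite -E; lia.
  by rewrite -E addKn.
move=> [n [us [nk Hus [->]]]]; move: Hus nk; rewrite mem_forests mem_index_iota.
by move=> /andP[/eqP -> /eqP ->] /andP[_]; rewrite ltnS => /subnKC.
Qed.
End TreeSums.

(** * B-series of the flow *)

Section PolynomialIntegral.
Variable R : realType.
Implicit Types q : {poly R}.

Definition primitive q : {poly R} :=
  \poly_(i < (size q).+1) (if i is j.+1 then q`_j / j.+1%:R else 0).

Lemma coef_primitive q i :
  (primitive q)`_i = if i is j.+1 then q`_j / j.+1%:R else 0.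
Proof.
rewrite coef_poly; case: i => [|i]; rewrite ?if_same // ltnS.
by case: ltnP => // si; rewrite nth_default ?mul0r.
Qed.

Lemma deriv_primitive q : (primitive q)^`() = q.
Proof.
apply/polyP => i; rewrite coef_deriv coef_primitive -[LHS]mulr_natr divfK //.
Qed.

Definition int01 q : R := \sum_(i < size q) q`_i / i.+1%:R.

Lemma int01_widen N q : (size q <= N)%N -> int01 q = \sum_(i < N) q`_i / i.+1%:R.
Proof.
move=> qN; rewrite /int01 (big_ord_widen N (fun i => q`_i / i.+1%:R)) //.
rewrite big_mkcond; apply: eq_bigr => i _.
by case: ltnP => // iq; rewrite nth_default ?mul0r.
Qed.

Lemma int01_linear : linear_for *%R int01.
Proof.
move=> a p q; pose N := maxn (size (a *: p + q)) (maxn (size p) (size q)).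
rewrite !(@int01_widen N) ?leq_max ?leqnn ?orbT //.
rewrite mulr_sumr -big_split; apply: eq_bigr => i _.
by rewrite coefD coefZ mulrDl mulrA.
Qed.

HB.instance Definition _ := GRing.isLinear.Build R {poly R} R *%R int01 int01_linear.

Lemma int01C c : int01 c%:P = c.
Proof.
rewrite (@int01_widen 1) ?size_polyC_leq1 // big_ord1 coefC invr1 mulr1 //.
Qed.

(** Taylor's formula at 0 integrated term by term; the integrals 1/(n+1)! of s^n / n! are the
    constants of phi. *)
Lemma int01_taylor N q : (forall n, (N <= n)%N -> q^`(n) = 0) ->
  int01 q = \sum_(n < N) ((n.+1)`!%:R)^-1 * q^`(n).[0].
Proof.
move=> qN; have d0 n : q^`(n).[0] = n`!%:R * q`_n.
  by rewrite horner_coef0 coef_derivn addn0 ffactnn [RHS]mulr_natl.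
have sq : (size q <= N)%N.
  apply/leq_sizeP => n Nn; have := d0 n; rewrite qN // horner0 => /esym/eqP.
  by rewrite mulf_eq0 pnatr_eq0 -leqn0 leqNgt fact_gt0 /= => /eqP.
rewrite (int01_widen sq); apply: eq_bigr => n _; rewrite d0 factS natrM invfM.
by rewrite -mulrA mulKf 1?mulrC // pnatr_eq0 -lt0n fact_gt0.
Qed.

End PolynomialIntegral.

Section TreeCoefficients.
Variable R : realType.

Fixpoint tree_weight (t : rtree) : R :=
  let: Node ts := t in (size ts)`!%:R^-1 * \prod_(w <- map tree_weight ts) w.

Lemma tree_weightE ts : tree_weight (Node ts) =
  (size ts)`!%:R^-1 * \prod_(t <- ts) tree_weight t.
Proof. by rewrite /= big_map. Qed.

(* The coefficient of F_t in the solution at time s of the rescaled flow started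
   at alpha: it solves c' = prod c(children), and has mean 0 over [0, 1]. *)
Fixpoint flow_coef (t : rtree) : {poly R} :=
  let: Node ts := t in let q := primitive (\prod_(c <- map flow_coef ts) c) in
  q - (int01 q)%:P.

Lemma flow_coefE ts : flow_coef (Node ts) =
  primitive (\prod_(t <- ts) flow_coef t) -
  (int01 (primitive (\prod_(t <- ts) flow_coef t)))%:P.
Proof. by rewrite /= big_map. Qed.

Lemma deriv_flow_coef ts : (flow_coef (Node ts))^`() = \prod_(t <- ts) flow_coef t.
Proof. by rewrite flow_coefE derivB derivC subr0 deriv_primitive. Qed.

Lemma int01_flow_coef t : int01 (flow_coef t) = 0.
Proof. by case: t => ts; rewrite flow_coefE linearB /= int01C subrr. Qed.

End TreeCoefficients.

Section BSeries.
Context {R : realType} {d : nat}.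
Local Notation T := (@cotangent R d).
Local Notation A := (smoothfun R d).
Variable X : 'I_d -> A.

Let Hdx (i : 'I_d) : derivation (sdx i : A -> A) := sderive_derivation _.

(** Contraction of an iterated derivative of f with the fields Ds, which are never differentiated
    themselves: this is not a composition of vector fields. *)
Definition diff_along (Ds : seq ('I_d -> A)) : A -> A :=
  foldr (fun D k f => \sum_i D i * k (sdx i f)) id Ds.

Fixpoint seldiff (t : rtree) (u : 'I_d) : A :=
  let: Node ts := t in diff_along (map seldiff ts) (X u).

Lemma diff_alongE (Ds : seq ('I_d -> A)) (f : A) z : diff_along Ds f z =
  \sum_(I : (size Ds).-tuple 'I_d) d_xs I f z *
    \prod_(q <- zip I Ds) q.2 q.1 z.
Proof.
elim: Ds f => [|D Ds ih] f /=.
  by rewrite big_tuple0 /= big_nil mulr1.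
rewrite big_tuple_cons smoothfun_sum; apply: eq_bigr => i _.
rewrite smoothfunM ih mulr_sumr; apply: eq_bigr => I _ /=.
rewrite big_cons mulrCA; congr (_ * _).
transitivity (sdxs I (sdx i f) z); first by rewrite sdxsE.
by rewrite sdxs_sdx -[RHS]/(d_xs (i :: I) f z) -sdxsE.
Qed.

Lemma seldiffE t u : seldiff t u = eldiff (fun i => X i) t u :> (T -> R).
Proof.
elim/rtree_ind_all: t u => ts IH u; apply/funext => z /=.
rewrite diff_alongE size_map; apply: eq_bigr => I _; congr (_ * _).
have : size I = size ts by rewrite size_tuple.
elim: ts IH {I}(tval I) => [|t ts ih] /=; first by move=> _ [] // _; rewrite !big_nil.
move=> [IHt IHts] [|i I] //= [sz]; rewrite !big_cons /= IHt; congr (_ * _).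
exact: ih.
Qed.

Section AtPoint.
Variable z : T.

Definition eval_poly : {rmorphism A -> {poly R}} := polyC \o smoothfun_eval z.

(** The part of the flow beyond x, divided by eps: order k therefore collects the trees with k + 1
    vertices. *)
Definition flow_tail (i : 'I_d) : ser {poly R} := fun k =>
  \sum_(t <- trees k) (tree_weight R t * seldiff t i z) *: flow_coef R t.

(** Expanding a product of n sums over plane trees produces ordered forests, so no symmetry factor
    appears. *)
Lemma taylor_sum_forests n f m : taylor_sum sdx eval_poly flow_tail n f m =
  \sum_(ts <- forests n m) (\prod_(t <- ts) tree_weight R t *
     diff_along (map seldiff ts) f z) *: \prod_(t <- ts) flow_coef R t.
Proof.
elim: n f m => [|n ih] f m.
  rewrite /= /serC; case: m => [|m]; rewrite ?big_nil // big_seq1 !big_nil mul1r.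
  by rewrite /= alg_polyC.
rewrite sum_forestsS [LHS](ser_sum _ _
  (fun i => flow_tail i * taylor_sum sdx eval_poly flow_tail n (sdx i f))).
under eq_bigr => i _ do rewrite serM.
rewrite exchange_big; apply: eq_bigr => a _ /=.
transitivity (\sum_(t <- trees a) \sum_(ts <- forests n (m - a)) \sum_i
    ((tree_weight R t * seldiff t i z) *: flow_coef R t) *
    ((\prod_(t <- ts) tree_weight R t *
     diff_along (map seldiff ts) (sdx i f) z) *: \prod_(t <- ts) flow_coef R t)).
  under [RHS]eq_bigr => t _ do rewrite exchange_big.
  rewrite [RHS]exchange_big; apply: eq_bigr => i _ /=.
  rewrite ih mulr_suml; apply: eq_bigr => t _.
  by rewrite mulr_sumr.
apply: eq_bigr => t _; apply: eq_bigr => ts _.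
rewrite !big_cons smoothfun_sum mulr_sumr scaler_suml; apply: eq_bigr => i _.
rewrite -scalerAl -scalerAr scalerA smoothfunM; congr (_ *: _).
by ring.
Qed.

Local Notation S := (subst sdx invfact eval_poly flow_tail).

(** The equation Z' = eps X(Z), with one eps divided out. Taylor's 1/n! is the root factor of
    [tree_weight], and [deriv_flow_coef] supplies the product over the children. *)
Lemma subst_vector_field u : S (X u) = ser_map (@deriv R) (flow_tail u).
Proof.
apply/serP => k; rewrite ser_mapE /flow_tail raddf_sum sum_trees.
apply: eq_bigr => n _; rewrite /taylor serCM taylor_sum_forests mulr_sumr.
rewrite big_seq [RHS]big_seq; apply: eq_bigr => ts.
rewrite mem_forests => /andP[/eqP sz _].
rewrite [RHS]derivZ deriv_flow_coef tree_weightE /= sz mul_polyC scalerA.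
by rewrite mulrA.
Qed.

Lemma deriv_derivation : derivation (@deriv R).
Proof. by split=> a b; [exact: derivD|exact: derivM]. Qed.

(** For the field Vbar this is [lie], whose iterates make up phi. *)
Definition along (f : A) : A := \sum_j X j * sdx j f.

Lemma deriv_subst f : ser_map (@deriv R) (S f) = serX _ * S (along f).
Proof.
rewrite (@subst_chain A d sdx invfact (fun i j g => sderiveC _ _ g) invfactP
  _ eval_poly flow_tail (@deriv R) (fun=> 0) deriv_derivation).
- rewrite [X in _ + X](_ : _ = 0); last first.
    by have /eqP := subst_zmod invfact Hdx eval_poly flow_tail 0 0;
      rewrite !subrr => /eqP.
  rewrite addr0; congr (_ * _).
  rewrite -[RHS]/(subst_rmorphism Hdx invfactP eval_poly flow_tail (along f)).
  rewrite rmorph_sum; apply: eq_bigr => j _.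
  by rewrite rmorphM /= subst_vector_field.
- by move=> g; rewrite /= derivC polyC0.
- by move=> i g; rewrite (der0 (Hdx i)).
Qed.

(** Each time derivative costs a factor eps, so more than k of them kill order k. This makes the
    Taylor expansion in time finite. *)
Lemma coef_deriv_subst n k f : (S f k)^`(n) =
  if (n <= k)%N then S (iter n along f) (k - n)%N else 0.
Proof.
rewrite -serXnM; suff -> : serX _ ^+ n * S (iter n along f) =
  iter n (ser_map (@deriv R)) (S f).
  by elim: n => // n ih; rewrite iterS ser_mapE -ih derivnS.
have DX : ser_map (@deriv R) (serX {poly R}) = 0.
  by apply/serP => m; rewrite ser_mapE /serX (der_nat deriv_derivation).
have DXn m : ser_map (@deriv R) (serX {poly R} ^+ m) = 0.
  elim: m => [|m ih]; first exact: der1 (derivation_ser_map deriv_derivation).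
  by rewrite exprS (derM (derivation_ser_map deriv_derivation)) ih DX mul0r mulr0 addr0.
elim: n => [|n ih] /=; first by rewrite mul1r.
rewrite -ih (derM (derivation_ser_map deriv_derivation)) DXn mul0r add0r.
by rewrite deriv_subst mulrA exprSr.
Qed.

Variable s : 'I_d -> @fseries R d.
Hypothesis sS : forall i k, s i k.+1 z =
  \sum_(t <- trees k) tree_weight R t * seldiff t i z * (flow_coef R t).[0].

(* Evaluating the flow at time 0 gives s, so Taylor's formula for the mean of
   the flow over [0, 1] is the Karasev equation. *)
Lemma karasev_at i k :
  \sum_(m < k.+1) subst sdx invfact (smoothfun_eval z) (tail_at s z)
    (invfact m.+1 * iter m along (sx i)) (k - m)%N = fconst (coord_x i) k z.
Proof.
have ev0 f m : (S f m).[0] =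
    subst sdx invfact (smoothfun_eval z) (tail_at s z) f m.
  rewrite -[LHS]/(ser_map (horner_eval (0 : R)) (S f) m) ser_map_subst.
  rewrite (@eq_subst_ev _ _ _ (horner_eval 0 \o eval_poly) (smoothfun_eval z)).
    apply: eq_subst_upto => j n _; rewrite ser_mapE /tail_at sS /flow_tail.
    rewrite rmorph_sum; apply: eq_bigr => t _.
    by rewrite /= /horner_eval hornerZ.
  by move=> g; rewrite /= /horner_eval hornerC.
(* S applied to a coordinate is the flow itself, and its terms beyond x have mean zero by the choice
   of [flow_coef]. *)
have : int01 (S (sx i) k) = fconst (coord_x i) k z.
  rewrite (subst_coord Hdx invfactP _ _ (fun l => sdx_sx l i)).
  rewrite serD serXM; case: k => [|k] /=; first by rewrite addr0 int01C.
  rewrite add0r /flow_tail raddf_sum big1 // => t _.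
  by rewrite /= linearZ /= int01_flow_coef mulr0.
(* The mean is now expanded in time derivatives at 0, where by [ev0] the flow is s. *)
move=> <-; rewrite (@int01_taylor _ k.+1); last first.
  by move=> n kn; rewrite coef_deriv_subst leqNgt kn.
apply: eq_bigr => m _; rewrite coef_deriv_subst -ltnS ltn_ord ev0.
rewrite -[LHS]/(subst_rmorphism Hdx invfactP _ _ _ _) rmorphM /=.
rewrite (subst_const Hdx invfactP) ?serCM // => j.
exact: (der_natV (Hdx j) (invfactP m.+1)).
Qed.

End AtPoint.
End BSeries.

(** * Cuts of a tree *)

Section SubsetSum.
Variable T : choiceType.

(* Subsets of the list E are given as boolean predicates, as in cut_edges. *)
Fixpoint subset_sum (M : nmodType) (E : seq T) (F : pred T -> M) : M :=
  if E is e :: E' then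
    subset_sum E' F + subset_sum E' (fun P => F (fun x => (x == e) || P x))
  else F (fun=> false).

(** Replaces finite sets by a recursion on the list of edges, which can follow the structure of the
    tree. *)
Lemma sum_fpowerset (M : nmodType) (E : seq T) (F : pred T -> M) : uniq E ->
  \sum_(P <- fpowerset [fset x in E]%fset) F (mem P) = subset_sum E F.
Proof.
elim: E F => [|e E ih] F /=.
  have -> : [fset x in [::]]%fset = fset0 :> {fset T} by apply/fsetP => x; rewrite !inE.
  rewrite fpowerset0 big_seq_fset1 => _; congr F; exact/funext.
move=> /andP[eE uE]; rewrite -!ih //.
have eS (P : {fset T}) : P \in fpowerset [fset x in E]%fset -> e \notin P.
  rewrite fpowersetE => /fsubsetP PE; apply: contra eE => /PE.
  by rewrite !inE.
transitivity (\sum_(P <- fpowerset [fset x in E]%fset ++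
  [seq (e |` P)%fset | P <- fpowerset [fset x in E]%fset]) F (mem P)); last first.
  rewrite big_cat big_map; congr (_ + _); apply: eq_bigr => P _.
  by congr F; apply/funext => x; exact: in_fset1U.
apply: perm_big; apply: uniq_perm; first exact: fset_uniq.
  rewrite cat_uniq fset_uniq map_inj_in_uniq ?fset_uniq ?andbT.
    apply/hasPn => _ /mapP[P PE ->]; apply: contraL (fset1U1 e P) => H.
    exact: eS H.
  move=> P Q /eS eP /eS eQ PQ; apply/fsetP => x.
  have /fsetP /(_ x) := PQ; rewrite !inE.
  by case: eqP => // -> _; rewrite (negbTE eP) (negbTE eQ).
move=> P; rewrite mem_cat fpowersetE; apply/idP/orP => [/fsubsetP PE|].
  have [eP|eP] := boolP (e \in P); [right|left].
    apply/mapP; exists (P `\ e)%fset; last by rewrite fsetD1K.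
    rewrite fpowersetE; apply/fsubsetP => x; rewrite !inE => /andP[xe /PE].
    by rewrite !inE (negbTE xe).
  rewrite fpowersetE; apply/fsubsetP => x xP; have := PE x xP; rewrite !inE.
  by case: eqP => // xe; rewrite -xe xP in eP.
case=> [|/mapP[Q]]; rewrite fpowersetE => /fsubsetP H.
  by apply/fsubsetP => x /H; rewrite !inE => ->; rewrite orbT.
move=> ->; apply/fsubsetP => x; rewrite !inE => /orP[->//|/H].
by rewrite !inE => ->; rewrite orbT.
Qed.

Lemma eq_subset_sum (M : nmodType) (E : seq T) (F G : pred T -> M) :
  (forall P : pred T, (forall x, P x -> x \in E) -> F P = G P) ->
  subset_sum E F = subset_sum E G.
Proof.
elim: E F G => [|e E ih] F G H /=; first by apply: H.
congr (_ + _); apply: ih => P PE; apply: H => x; rewrite inE.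
  by move/PE => ->; rewrite orbT.
by case/orP => [->//|/PE ->]; rewrite orbT.
Qed.

Lemma subset_sum_cat (M : nmodType) (E1 E2 : seq T) (F : pred T -> M) :
  subset_sum (E1 ++ E2) F = subset_sum E1 (fun P =>
    subset_sum E2 (fun Q => F (fun x => P x || Q x))).
Proof.
elim: E1 F => [|e E1 ih] F //=; rewrite !ih; congr (_ + _).
apply: eq_subset_sum => P _; apply: eq_subset_sum => Q _.
by congr F; apply/funext => x; rewrite orbA.
Qed.

Lemma raddf_subset_sum (M N : nmodType) (h : {additive M -> N}) E (F : pred T -> M) :
  h (subset_sum E F) = subset_sum E (fun P => h (F P)).
Proof. by elim: E F => [|e E ih] F //=; rewrite raddfD !ih. Qed.

Lemma subset_sumD (M : nmodType) E (F G : pred T -> M) :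
  subset_sum E (fun P => F P + G P) = subset_sum E F + subset_sum E G.
Proof. by elim: E F G => [|e E ih] F G //=; rewrite !ih addrACA. Qed.

Lemma subset_sum0 (M : nmodType) E : subset_sum E (fun=> 0 : M) = 0.
Proof. by elim: E => //= e E ->; rewrite addr0. Qed.

Lemma subset_sumMl (K : pzSemiRingType) c E (F : pred T -> K) :
  subset_sum E (fun P => c * F P) = c * subset_sum E F.
Proof. by elim: E F => [|e E ih] F //=; rewrite mulrDr !ih. Qed.

Lemma subset_sumMr (K : pzSemiRingType) c E (F : pred T -> K) :
  subset_sum E (fun P => F P * c) = subset_sum E F * c.
Proof. by elim: E F => [|e E ih] F //=; rewrite mulrDl !ih. Qed.

End SubsetSum.

Lemma subset_sum_map_cons (M : nmodType) (i : nat) (E : seq (seq nat))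
    (F : pred (seq nat) -> M) :
  subset_sum [seq i :: a | a <- E] F = subset_sum E (fun P =>
    F (fun x => if x is j :: y then (j == i) && P y else false)).
Proof.
elim: E F => [|e E ih] F /=.
  by congr F; apply/funext => -[|j y] //; rewrite andbF.
rewrite !ih; congr (_ + _); apply: eq_subset_sum => P _; congr F.
by apply/funext => -[|j y] //; rewrite eqseq_cons; case: eqP.
Qed.

Lemma big_indexed_map (T U : Type) (f : T -> U) m (s : seq T) :
  zip (iota m (size (map f s))) (map f s) =
  [seq (p.1, f p.2) | p <- zip (iota m (size s)) s].
Proof. by elim: s m => //= x s ih m; rewrite ih. Qed.

(* The edges of Node ts, the children being numbered from m on. *)
Definition child_edges (m : nat) (ts : seq rtree) : seq (seq nat) :=
  flatten [seq [seq p.1 :: a | a <- addresses p.2] | p <- zip (iota m (size ts)) ts].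

Lemma addressesE ts : addresses (Node ts) = [::] :: child_edges 0 ts.
Proof.
rewrite /= /indexed big_indexed_map -map_comp; congr (_ :: flatten _).
Qed.

Lemma child_edges_cons m t ts : child_edges m (t :: ts) =
  [seq m :: a | a <- addresses t] ++ child_edges m.+1 ts.
Proof. by []. Qed.

Lemma mem_child_edges m ts x : x \in child_edges m ts ->
  if x is i :: _ then (m <= i)%N else false.
Proof.
elim: ts m x => // t ts ih m x; rewrite child_edges_cons mem_cat.
case/orP => [/mapP[a _ ->]//|/ih]; case: x => // i x; exact: ltnW.
Qed.

Lemma child_edges_uniq m ts :
  foldr (fun t => and (uniq (addresses t))) True ts -> uniq (child_edges m ts).
Proof.
elim: ts m => // t ts ih m [ut /ih uts]; rewrite child_edges_cons cat_uniq uts.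
rewrite map_inj_uniq ?ut ?andbT /=; last by move=> a b [].
apply/hasPn => x /mem_child_edges; case: x => // i x mi.
by apply/mapP => -[a _ [im _]]; rewrite im ltnn in mi.
Qed.

Lemma addresses_uniq t : uniq (addresses t).
Proof.
elim/rtree_ind_all: t => ts /(child_edges_uniq 0); rewrite addressesE /= => ->.
by rewrite andbT; apply/negP => /mem_child_edges.
Qed.

(** Distributivity: a set of edges is an independent choice for each child. In [addresses t] the
    address [::] stands for the edge above the root of the child t. *)
Lemma subset_sum_child_edges (K : comPzRingType)
    (W : rtree -> pred (seq nat) -> K) m ts :
  subset_sum (child_edges m ts)
    (fun P => \prod_(p <- zip (iota m (size ts)) ts) W p.2 (fun a => P (p.1 :: a))) =
  \prod_(t <- ts) subset_sum (addresses t) (W t).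
Proof.
elim: ts m => [|t ts ih] m; first by rewrite /= !big_nil.
rewrite child_edges_cons subset_sum_cat subset_sum_map_cons big_cons -(ih m.+1).
rewrite -subset_sumMr; apply: eq_subset_sum => P _.
rewrite -subset_sumMl; apply: eq_subset_sum => Q HQ.
rewrite big_cons /=; congr (W t _ * _).
  (* Q selects edges of later children only, whose addresses begin with a number above m. *)
  apply/funext => a; rewrite eqxx /= orbC; case: (boolP (Q _)) => // /HQ.
  by move=> /mem_child_edges; rewrite ltnn.
rewrite big_seq [RHS]big_seq; apply: eq_bigr => -[i u] /= iu; congr (W u _).
apply/funext => a; suff -> : (i == m) = false by [].
have : i \in map fst (zip (iota m.+1 (size ts)) ts) by apply/mapP; exists (i, u).
by rewrite -/unzip1 unzip1_zip ?size_iota // mem_iota; case: eqP => // ->; rewrite ltnn.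
Qed.

Definition cut_children (P : pred (seq nat)) m ts :=
  [seq (P [:: p.1], cut_edges p.2 (fun a => P (p.1 :: a)))
     | p <- zip (iota m (size ts)) ts].

Lemma cut_edgesE ts P : cut_edges (Node ts) P =
  (Node [seq r.2.1 | r <- cut_children P 0 ts & ~~ r.1],
   flatten [seq (if r.1 then r.2.1 :: r.2.2 else r.2.2) | r <- cut_children P 0 ts]).
Proof. by rewrite /= /indexed big_indexed_map -!map_comp. Qed.

(** Turns the sign (-1)^|P_t| into one factor -1 for each component. *)
Lemma nb_vertices_contract t P : nb_vertices (contract_edges t P) = size (erase t P).
Proof.
elim/rtree_ind_all: t P => ts IH P; rewrite /erase cut_edgesE /=.
rewrite /indexed big_indexed_map -map_comp; congr S.
elim: ts 0%N IH => //= t ts ih m [IHt IHts].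
rewrite map_cat sumn_cat size_cat -ih //; congr addn.
have := IHt (fun a => P (m :: a)); rewrite /erase /=.
by case: contract_edges => us /= [E]; case: (P [:: m]); rewrite /= ?E ?addn0.
Qed.

Lemma tree_fact_Node ts : tree_fact (Node ts) =
  (nb_vertices (Node ts) * \prod_(t <- ts) tree_fact t)%N.
Proof. by rewrite /= big_map. Qed.

Section TreeCoef.
Variable R : realType.

Definition average_coef (t : rtree) : R := 1 / (tree_fact t * (nb_vertices t).+1)%N%:R.

(* The coefficient of F_t in the flow at time s started at x. *)
Definition exact_coef (t : rtree) : {poly R} :=
  (tree_fact t)%:R^-1 *: 'X^(nb_vertices t).

Lemma deriv_exact_coef ts :
  (exact_coef (Node ts))^`() = \prod_(t <- ts) exact_coef t.
Proof.
have E : \prod_(t <- ts) exact_coef t =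
    ((\prod_(t <- ts) tree_fact t)%N%:R^-1 : R) *: 'X^(sumn (map nb_vertices ts)).
  elim: ts => [|t ts ih]; first by rewrite !big_nil invr1 scale1r expr0.
  rewrite !big_cons ih /exact_coef -scalerAl -scalerAr scalerA -exprD.
  by rewrite natrM invfM.
rewrite E /exact_coef tree_fact_Node derivZ derivXn.
have -> : nb_vertices (Node ts) = (sumn (map nb_vertices ts)).+1 by [].
set n := sumn _; rewrite /= -[_ *+ n.+1]scaler_nat scalerA natrM invfM.
by rewrite mulrAC mulVf ?mul1r // pnatr_eq0.
Qed.

Lemma int01_exact_coef t : int01 (exact_coef t) = average_coef t.
Proof.
rewrite /exact_coef linearZ /= /int01 size_polyXn big_ord_recr big1 ?add0r => [|i _].
  rewrite /= coefXn eqxx /average_coef natrM invfM !mul1r add0r //.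
by rewrite coefXn /= ltn_eqF ?mul0r.
Qed.

Lemma exact_coef0 t : (exact_coef t).[0] = 0.
Proof.
rewrite /exact_coef hornerZ hornerXn expr0n.
by have := nb_vertices_gt0 t; case: nb_vertices => //= n _; rewrite mulr0.
Qed.

Let na (t : rtree) : {poly R} := (- average_coef t)%:P.

Definition cut_weight (g : rtree -> {poly R}) t (P : pred (seq nat)) :=
  g (cut_edges t P).1 * \prod_(u <- (cut_edges t P).2) na u.

(** The address [::] represents an edge above the root of t. If it is cut, the root component is
    detached and weighs minus its average; otherwise it belongs to a larger component and keeps its
    polynomial. *)
Definition hanging_weight t (P : pred (seq nat)) :=
  cut_weight (if P [::] then na else exact_coef) t P.

(** Components away from the root are constant in time, and differentiating the root component
    strips its root. What is left factors over the children, each cut off or still attached. *)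
Lemma deriv_cut_weight ts P : (cut_weight exact_coef (Node ts) P)^`() =
  \prod_(p <- zip (iota 0 (size ts)) ts) hanging_weight p.2 (fun a => P (p.1 :: a)).
Proof.
have dna (s : seq rtree) : (\prod_(u <- s) na u)^`() = 0.
  by rewrite -rmorph_prod derivC.
rewrite /cut_weight derivM dna mulr0 addr0 cut_edgesE deriv_exact_coef /=.
rewrite big_map big_filter big_flatten /= !big_map big_mkcond -big_split /=.
apply: eq_bigr => p _; rewrite /hanging_weight /cut_weight.
by case: (P _) => /=; rewrite ?mul1r ?big_cons.
Qed.

Lemma tree_coef_cut t : (tree_coef R t)%:P =
  subset_sum (behead (addresses t)) (cut_weight na t).
Proof.
have ut := addresses_uniq t; rewrite /tree_coef.
have -> : edges t = [fset x in behead (addresses t)]%fset.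
  case: t ut => ts; rewrite /edges addressesE.
  move: (child_edges 0 ts) => L /andP[/= ne _]; apply/fsetP => x.
  rewrite !inE; case: eqP => [->|_]; rewrite ?(negbTE ne) ?andbT //.
rewrite (sum_fpowerset (fun P => (-1) ^+ nb_vertices (contract_edges t P) *
  \prod_(u <- erase t P) average_coef u)); last first.
  by case: t ut => ts; rewrite addressesE => /andP[].
rewrite (raddf_subset_sum (@polyC R)); apply: eq_subset_sum => P _.
rewrite nb_vertices_contract /cut_weight /erase.
move: (cut_edges t P) => -[u us] /=.
rewrite -(big_cons _ _ u us xpredT na) -rmorph_prod; congr _%:P.
rewrite -[(size us).+1]/(size (u :: us)).
elim: (u :: us) => [|v vs ih]; first by rewrite !big_nil mulr1.
by rewrite !big_cons -ih /= exprS; ring.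
Qed.

Lemma hanging_split u : subset_sum (addresses u) (hanging_weight u) =
  subset_sum (behead (addresses u)) (cut_weight exact_coef u) + (tree_coef R u)%:P.
Proof.
rewrite tree_coef_cut; case: u => ts; rewrite addressesE /=.
congr (_ + _); apply: eq_subset_sum => P PE; rewrite /hanging_weight.
by case: (boolP (P [::])) => // /PE /mem_child_edges.
Qed.

(** The cut sum has the two properties that determine [flow_coef], its derivative and its zero mean.
    The mean vanishes because cutting the edge above the root replaces the polynomial of the root
    component by minus its mean. *)
Lemma flow_coef_cut t : flow_coef R t =
  subset_sum (addresses t) (hanging_weight t).
Proof.
have mean u : int01 (subset_sum (addresses u) (hanging_weight u)) = 0.
  have -> : subset_sum (addresses u) (hanging_weight u) =
      subset_sum (behead (addresses u))
        (fun P => cut_weight exact_coef u P + cut_weight na u P).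
    by rewrite hanging_split tree_coef_cut -subset_sumD.
  rewrite (raddf_subset_sum (@int01 R)); rewrite -[RHS](subset_sum0 _ (behead (addresses u))).
  apply: eq_subset_sum => P _; rewrite /cut_weight /= -rmorph_prod.
  rewrite raddfD /= -polyCM int01C ![_ * _%:P]mulrC mul_polyC linearZ /=.
  by rewrite int01_exact_coef mulNr mulrC subrr.
elim/rtree_ind_all: t => ts IH.
set c := subset_sum _ _.
have dc : c^`() = \prod_(t <- ts) flow_coef R t.
  rewrite /c hanging_split derivD derivC addr0 addressesE /=.
  rewrite (raddf_subset_sum (@deriv R)).
  rewrite (eq_subset_sum (fun P _ => deriv_cut_weight ts P)).
  rewrite (subset_sum_child_edges hanging_weight).
  elim: (ts) IH => [|t us ih] /=; first by rewrite !big_nil.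
  by case=> E /ih; rewrite !big_cons E => ->.
have : (c - flow_coef R (Node ts))^`() = 0.
  by rewrite derivB dc deriv_flow_coef subrr.
have : int01 (c - flow_coef R (Node ts)) = 0.
  by rewrite raddfB [X in X - _]mean [X in _ - X]int01_flow_coef subrr.
move=> I0 D0; apply/eqP; rewrite eq_sym -subr_eq0; apply/eqP.
move: (c - _) I0 D0 => q I0 D0; have C : q = (q`_0)%:P.
  apply/polyP => -[|i]; rewrite coefC //=.
  have := congr1 (fun r : {poly R} => r`_i) D0; rewrite coef_deriv coef0 => /eqP.
  by rewrite mulrn_eq0 => /eqP.
by move: I0; rewrite C int01C => ->.
Qed.

(** At time 0 the polynomial of an attached root component vanishes, so only the sets that cut the
    edge above the root survive. *)
Lemma tree_coef_flow t : tree_coef R t = (flow_coef R t).[0].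
Proof.
rewrite flow_coef_cut.
have -> : subset_sum (addresses t) (hanging_weight t) =
    subset_sum (behead (addresses t)) (cut_weight exact_coef t) + (tree_coef R t)%:P.
  exact: hanging_split.
rewrite hornerD hornerC -[LHS]add0r; congr (_ + _).
rewrite -/(horner_eval 0 _) (raddf_subset_sum (horner_eval (0 : R))).
rewrite -[LHS](subset_sum0 _ (behead (addresses t))); apply: eq_subset_sum => P _.
by rewrite /cut_weight /= /horner_eval hornerM exact_coef0 mul0r.
Qed.
End TreeCoef.

(** * Counting isomorphisms *)

Lemma inj_surj_bij (T U : Type) (f : T -> U) :
  injective f -> (forall y, exists x, f x = y) -> bijective f.
Proof.
move=> fi fs; exists (fun y => projT1 (cid (fs y))) => x.
  by apply: fi; case: cid.
by case: cid.
Qed.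

(** Splitting off a child leaves a disjoint sum, which is not a set of addresses; isomorphisms are
    therefore counted on abstract graphs. *)
Record rooted_graph := RootedGraph { vertex :> finType; is_root : pred vertex; edge : rel vertex }.

Section Isos.
Implicit Types G H : rooted_graph.

Definition graph_map G H (f : G -> H) : Prop :=
  (forall v, is_root (f v) = is_root v) /\ (forall v w, edge (f v) (f w) = edge v w).

Definition isos G H : {set {ffun G -> H}} :=
  [set f : {ffun G -> H} | `[< bijective f /\ graph_map f >]].

Lemma in_isos G H (f : {ffun G -> H}) :
  reflect (bijective f /\ graph_map f) (f \in isos G H).
Proof. by rewrite inE; exact: asboolP. Qed.

Lemma in_isos_finfun G H (f : G -> H) : bijective f -> graph_map f ->
  finfun f \in isos G H.
Proof.
move=> bf [fr fe]; apply/in_isos; split; first by apply: (eq_bij bf) => x; rewrite ffunE.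
by split=> [v|v w]; rewrite !ffunE.
Qed.

Lemma graph_map_comp G H (K : rooted_graph) (f : G -> H) (g : H -> K) :
  graph_map f -> graph_map g -> graph_map (g \o f).
Proof.
by move=> [fr fe] [gr ge]; split=> [v|v w] /=; rewrite ?gr ?fr ?ge ?fe.
Qed.

Lemma graph_map_can G H (f : G -> H) (g : H -> G) :
  cancel g f -> graph_map f -> graph_map g.
Proof.
by move=> gK [fr fe]; split=> [v|v w]; rewrite -?fr -?fe !gK.
Qed.

Lemma card_isos_transport G H G' H' (a : G' -> G) (b : H -> H')
    (P : pred {ffun G -> H}) (P' : pred {ffun G' -> H'}) :
  bijective a -> graph_map a -> bijective b -> graph_map b ->
  (forall f : {ffun G -> H}, P' [ffun x => b (f (a x))] = P f) ->
  #|[set f in isos G H | P f]| = #|[set f in isos G' H' | P' f]|.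
Proof.
move=> ba ga bb gb PP'; have [a' aK a'K] := ba; have [b' bK b'K] := bb.
pose F (f : {ffun G -> H}) : {ffun G' -> H'} := [ffun x => b (f (a x))].
have Fi : injective F.
  move=> f g /ffunP fg; apply/ffunP => x; have := fg (a' x).
  by rewrite !ffunE a'K => /(can_inj bK).
rewrite -(card_imset _ Fi); apply: eq_card => f'.
rewrite [RHS]inE; apply/imsetP/andP => [[f]|[/in_isos [bf' gf'] Pf']].
  rewrite inE => /andP[/in_isos [bf gf] Pf] ->; rewrite /F PP'; split=> //.
  apply: (in_isos_finfun (f := b \o f \o a)).
    exact: bij_comp (bij_comp bb bf) ba.
  exact: graph_map_comp ga (graph_map_comp gf gb).
have E : f' = F [ffun y => b' (f' (a' y))].
  by apply/ffunP => x; rewrite !ffunE aK b'K.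
exists [ffun y => b' (f' (a' y))] => //; rewrite inE -PP' -/(F _) -E Pf' andbT.
apply: (in_isos_finfun (f := b' \o f' \o a')).
  by apply: bij_comp (bij_comp _ bf') _; [exists b|exists a].
apply: graph_map_comp (graph_map_can a'K ga) _.
exact: graph_map_comp gf' (graph_map_can b'K gb).
Qed.

Lemma card_isosT G H : #|[set f in isos G H | true]| = #|isos G H|.
Proof. by apply: eq_card => f; rewrite inE andbT. Qed.

Lemma card_isos_r G H H' (b : H -> H') : bijective b -> graph_map b ->
  #|isos G H| = #|isos G H'|.
Proof.
move=> bb gb; rewrite -!card_isosT.
by apply: (card_isos_transport (a := @id G) (b := b)) => //; exists id.
Qed.

Lemma isos_card G H : (0 < #|isos G H|)%N -> #|G| = #|H|.
Proof. by case/card_gt0P => f /in_isos [bf _]; exact: bij_eq_card bf. Qed.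

Definition hang (A B : rooted_graph) : rooted_graph := {|
  vertex := (A + B)%type;
  is_root v := if v is inr b then is_root b else false;
  edge v w := match v, w with
    | inl a, inl a' => edge a a'
    | inr b, inr b' => edge b b'
    | inr b, inl a => is_root b && is_root a
    | inl _, inr _ => false end |}.

(** Just enough of the tree structure to propagate statements from the root by induction on the
    depth. *)
Definition arborescence G (v0 : G) (depth : G -> nat) : Prop :=
  (forall v, is_root v = (v == v0)) /\
  (forall v, v != v0 -> exists2 w, edge w v & (depth w < depth v)%N).

(** Fixing the image of the root of A forces A onto A' and B onto B', as one sees by following edges
    away from the roots; such isomorphisms are thus pairs. *)
Lemma card_isos_hang (A B A' B' : rooted_graph) (a0 : A) (b0 : B) (a0' : A') (b0' : B')
    dA dB dA' dB' :
  arborescence a0 dA -> arborescence b0 dB ->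
  arborescence a0' dA' -> arborescence b0' dB' ->
  #|[set f in isos (hang A B) (hang A' B') | f (inl a0) == inl a0']| =
  (#|isos A A'| * #|isos B B'|)%N.
Proof.
move=> [rA pA] [rB pB] [rA' pA'] [rB' pB'].
pose F0 (p : {ffun A -> A'} * {ffun B -> B'}) (x : hang A B) : hang A' B' :=
  match x with inl a => inl (p.1 a) | inr b => inr (p.2 b) end.
pose F p : {ffun hang A B -> hang A' B'} := finfun (F0 p).
have Fi : injective F.
  move=> [g h] [g' h'] /ffunP E; congr (_, _); apply/ffunP => x.
    by have := E (inl x); rewrite !ffunE => -[].
  by have := E (inr x); rewrite !ffunE => -[].
rewrite -cardsX -(card_imset _ Fi); apply: eq_card => f.
rewrite [LHS]inE; apply/andP/imsetP => [[/in_isos [bf [fr fe]] /eqP f0]|]; last first.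
  case=> -[g h]; rewrite inE => /andP[/in_isos [/= bg [gr ge]] /in_isos [bh [hr he]]] ->.
  have g0 : g a0 = a0' by apply/eqP; rewrite -rA' gr rA.
  split; last by rewrite ffunE /= g0.
  apply: (in_isos_finfun (f := F0 (g, h))); last first.
    by split=> [[a|b]|[a|b] [a'|b']] //=; rewrite ?ge ?he ?hr ?gr.
  apply: inj_surj_bij => [[a|b] [a'|b'] // []|[a|b]].
  - by move/(bij_inj bg) => ->.
  - by move/(bij_inj bh) => ->.
  - by have [g' _ g'K] := bg; exists (inl (g' a)); rewrite /= g'K.
  - by have [h' _ h'K] := bh; exists (inr (h' b)); rewrite /= h'K.
have fi := bij_inj bf.
have fA a : {a' | f (inl a) = inl a'}.
  apply: cid; elim/ltn_ind: {a}(dA a) {-2}a (erefl (dA a)) => n ih a an.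
  have [->|/pA[p pa ltp]] := eqVneq a a0; first by exists a0'.
  have [p' fp] := ih _ (leq_trans ltp (eq_leq an)) p erefl.
  have := fe (inl p) (inl a); rewrite fp /= pa.
  by case: (f (inl a)) => // a' _; exists a'.
have fB b : {b' | f (inr b) = inr b'}.
  apply: cid; elim/ltn_ind: {b}(dB b) {-2}b (erefl (dB b)) => n ih b bn.
  have [bb|/pB[p pb ltp]] := eqVneq b b0.
    have := fr (inr b); rewrite /= rB bb eqxx.
    by case: (f _) => // b' _; exists b'.
  have [p' fp] := ih _ (leq_trans ltp (eq_leq bn)) p erefl.
  have := fe (inr p) (inr b); rewrite fp /= pb.
  (* An edge from B' into A' ends at the root of A', which is already the image of the root of A. *)
  case E : (f (inr b)) => [a'|b'] /=; last by exists b'.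
  rewrite rA' => /andP[_ /eqP a'0].
  by have /fi : f (inr b) = f (inl a0) by rewrite E f0 a'0.
pose g := [ffun a => sval (fA a)]; pose h := [ffun b => sval (fB b)].
have gE a : f (inl a) = inl (g a) by rewrite ffunE; case: (fA a).
have hE b : f (inr b) = inr (h b) by rewrite ffunE; case: (fB b).
exists (g, h); last by apply/ffunP => -[a|b]; rewrite ffunE /= ?gE ?hE.
have [f' fK f'K] := bf.
rewrite inE; apply/andP; split; apply/in_isos; split.
- apply: inj_surj_bij => [a a' E|a'].
    by have /fi [] : f (inl a) = f (inl a') by rewrite !gE E.
  have := f'K (inl a'); case: (f' _) => [a|b]; last by rewrite hE.
  by rewrite gE => -[]; exists a.
- split=> [a|a a'].
    rewrite rA' rA; apply/eqP/eqP => [E|->].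
      by have /fi [] : f (inl a) = f (inl a0) by rewrite gE f0 E.
    by have := f0; rewrite gE => -[].
  by have := fe (inl a) (inl a'); rewrite !gE.
- apply: inj_surj_bij => [b b' E|b'].
    by have /fi [] : f (inr b) = f (inr b') by rewrite !hE E.
  have := f'K (inr b'); case: (f' _) => [a|b]; first by rewrite gE.
  by rewrite hE => -[]; exists b.
- split=> [b|b b']; first by have := fr (inr b); rewrite hE.
  by have := fe (inr b) (inr b'); rewrite !hE.
Qed.

End Isos.

Definition remove_nth (T : Type) j (s : seq T) := take j s ++ drop j.+1 s.

Lemma size_remove_nth (T : Type) j (s : seq T) : (j < size s)%N ->
  size (remove_nth j s) = (size s).-1.
Proof.
by move=> js; rewrite size_cat size_drop size_takel ?(ltnW js) //; lia.
Qed.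

Lemma nth_remove_nth (T : Type) x0 j (s : seq T) i : (j < size s)%N ->
  nth x0 (remove_nth j s) i = nth x0 s (bump j i).
Proof.
move=> js; rewrite nth_cat size_takel ?(ltnW js) // /bump.
case: ltnP => ij; first by rewrite nth_take // add0n.
by rewrite nth_drop; congr nth; lia.
Qed.

Lemma perm_remove_nth (T : eqType) x0 j (s : seq T) : (j < size s)%N ->
  perm_eq s (nth x0 s j :: remove_nth j s).
Proof.
move=> js; rewrite -{1}(cat_take_drop j s) (drop_nth x0 js).
by rewrite perm_sym /remove_nth -[_ :: (_ ++ _)]cat1s perm_catCA.
Qed.

Notation leaf := (Node [::]).

Lemma mem_child_edges_cons m ts i a : (i :: a \in child_edges m ts) =
  [&& (m <= i)%N, (i < m + size ts)%N & a \in addresses (nth leaf ts (i - m))].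
Proof.
elim: ts m => [|t ts ih] m.
  by rewrite /child_edges /= addn0 in_nil; case: (leqP m i) => // mi; rewrite ltnNge mi.
rewrite child_edges_cons mem_cat ih.
have -> : (i :: a \in [seq m :: b | b <- addresses t]) = (i == m) && (a \in addresses t).
  apply/mapP/andP => [[b bt [-> ->]]|[/eqP -> at_]]; first by rewrite eqxx.
  by exists a.
case: (ltngtP m i) => [mi|im|->] /=.
- rewrite addSnnS; congr (_ && (_ \in addresses _)).
  by rewrite -[(i - m)%N]prednK ?subn_gt0 //= subnS.
- by [].
- by rewrite subnn /= orbF addnS ltnS leq_addr.
Qed.

Lemma mem_addresses_cons ts i a : (i :: a \in addresses (Node ts)) =
  (i < size ts)%N && (a \in addresses (nth leaf ts i)).
Proof. by rewrite addressesE inE mem_child_edges_cons subn0 add0n. Qed.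

Lemma root_mem t : [::] \in vertices t.
Proof. by case: t => ts; rewrite /vertices !inE. Qed.

Lemma mem_vertices t a : (a \in vertices t) = (a \in addresses t).
Proof. by rewrite /vertices !inE. Qed.

Lemma belast_mem t i a : i :: a \in addresses t -> belast i a \in addresses t.
Proof.
elim: a t i => [|j a ih] t i; first by move=> _; rewrite /= -mem_vertices root_mem.
case: t => ts; rewrite [belast _ _]/= !mem_addresses_cons => /andP[-> /=].
exact: ih.
Qed.

Definition tree_graph (t : rtree) : rooted_graph := {|
  vertex := vertices t;
  is_root v := fsval v == [::];
  edge v w := is_parent (fsval v) (fsval w) |}.

Definition tree_root t : tree_graph t := [` root_mem t]%fset.

Lemma tree_arborescence t :
  arborescence (tree_root t) (fun v : tree_graph t => size (fsval v)).
Proof.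
split=> [v|v]; first by rewrite -val_eqE.
rewrite -val_eqE /=; case: v => -[|i a] //= H _.
have Hb : belast i a \in vertices t.
  by rewrite mem_vertices; apply: belast_mem; rewrite -mem_vertices.
by exists [` Hb]%fset; rewrite //= size_belast.
Qed.

Section HangChild.
Variables (us : seq rtree) (j : nat).
Hypothesis js : (j < size us)%N.
Let G := hang (tree_graph (nth leaf us j)) (tree_graph (Node (remove_nth j us))).

Definition hang_address (x : G) : seq nat :=
  match x with
  | inl a => j :: fsval a
  | inr b => if fsval b is i :: a then bump j i :: a else [::]
  end.

Lemma hang_address_mem x : hang_address x \in vertices (Node us).
Proof.
rewrite mem_vertices; case: x => [[a]|[[|i a]]] /= H.
- by rewrite mem_addresses_cons js -mem_vertices.
- by rewrite inE.
move: H; rewrite mem_vertices !mem_addresses_cons size_remove_nth //.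
rewrite nth_remove_nth // => /andP[i1 ->]; rewrite andbT /bump.
by move: js i1; case: (j <= i)%N; lia.
Qed.

Definition hang_child (x : G) : tree_graph (Node us) := [` hang_address_mem x]%fset.

Lemma hang_child_graph_map : graph_map hang_child.
Proof.
split=> [[a|[[|i a] H]]|] //=.
have nb i : (bump j i == j) = false by rewrite eq_sym; apply/negbTE/neq_bump.
have bE i i' : (bump j i == bump j i') = (i == i').
  exact: (inj_eq (can_inj (@bumpK j))).
move=> [[a Ha]|[b Hb]] [[a' Ha']|[b' Hb']] /=.
- by case: a' {Ha'} => [|y s] //=; rewrite eqseq_cons eqxx.
- case: b' {Hb'} => [|i [|y s]] //=.
  by rewrite eqseq_cons eq_sym nb.
- case: b {Hb} => [|i b]; case: a' {Ha'} => [|y s] //=.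
  by rewrite eqseq_cons nb.
- case: b' {Hb'} => [|i' [|y' s']] //=; case: b {Hb} => [|i b] //=.
  by rewrite !eqseq_cons bE.
Qed.

Lemma hang_child_bij : bijective hang_child.
Proof.
apply: inj_surj_bij => [x y /(congr1 val) /=|[[|i a] H]].
- case: x y => [a|[[|i b] H]] [a'|[[|i' b'] H']] //=.
  + by move=> [E]; congr inl; apply: val_inj.
  + by move=> [/eqP]; rewrite (negbTE (neq_bump j i')).
  + by move=> _; congr inr; apply: val_inj.
  + by move=> [/eqP]; rewrite eq_sym (negbTE (neq_bump j i)).
  + by move=> [/(can_inj (@bumpK j)) E E']; congr inr; apply: val_inj; rewrite /= E E'.
- by exists (inr (tree_root _)); apply: val_inj.
have := H; rewrite mem_vertices mem_addresses_cons => /andP[ius ai].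
have [ij|ij] := eqVneq i j.
  have Ha : a \in vertices (nth leaf us j) by rewrite mem_vertices -ij.
  by exists (inl [` Ha]%fset); apply: val_inj; rewrite /= ij.
have bu : bump j (unbump j i) = i by rewrite unbumpK // inE.
have Hb : unbump j i :: a \in vertices (Node (remove_nth j us)).
  rewrite mem_vertices mem_addresses_cons size_remove_nth // nth_remove_nth // bu ai.
  by move: ij; rewrite andbT /unbump neq_ltn; case: (ltnP j i); lia.
by exists (inr [` Hb]%fset); apply: val_inj; rewrite /= bu.
Qed.

End HangChild.

Definition niso (t u : rtree) : nat := #|isos (tree_graph t) (tree_graph u)|.

(** The root of the first child goes to some address [:: j], and the isomorphism then splits by
    [card_isos_hang]. So [niso] expands like a permanent along its first row. *)
Lemma niso_cons t ts us : niso (Node (t :: ts)) (Node us) =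
  (\sum_(j < size us) niso t (nth leaf us j) * niso (Node ts) (Node (remove_nth j us)))%N.
Proof.
have js0 : (0 < size (t :: ts))%N by [].
pose c0 : tree_graph (Node (t :: ts)) := hang_child js0 (inl (tree_root _)).
pose fixes (f : {ffun tree_graph (Node (t :: ts)) -> tree_graph (Node us)})
  (j : nat) := fsval (f c0) == [:: j].
transitivity (\sum_(j < size us) #|[set f in isos _ _ | fixes f j]|)%N.
  rewrite /niso -sum1_card.
  transitivity (\sum_(f in isos (tree_graph (Node (t :: ts))) (tree_graph (Node us)))
     \sum_(j < size us) (fixes f j : nat))%N.
    apply: eq_bigr => f /in_isos [_ [fr fe]].
    have := fe (tree_root _) c0; have := fr (tree_root _).
    rewrite /fixes /= eqxx => /eqP ->; case: (f c0) => -[|i [|k a]] //= H _.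
    have : (i < size us)%N.
      by move: (H); rewrite mem_vertices mem_addresses_cons => /andP[].
    move=> ius; rewrite (bigD1 (Ordinal ius)) //= eqxx big1 // => k.
    by rewrite -val_eqE /= => /negbTE; rewrite eqseq_cons eq_sym => ->.
  rewrite exchange_big; apply: eq_bigr => j _ /=.
  rewrite -sum1_card big_mkcond [RHS]big_mkcond.
  by apply: eq_bigr => f _ /=; rewrite !inE; case: asboolP; case: (fixes _ _).
apply: eq_bigr => -[j js] _ /=.
have [b' bK b'K] := hang_child_bij js.
rewrite (card_isos_transport (a := hang_child js0) (b := b')
  (P' := fun f => f (inl (tree_root t)) == inl (tree_root (nth leaf us j)))).
- by rewrite (card_isos_hang (tree_arborescence _) (tree_arborescence _)
    (tree_arborescence _) (tree_arborescence _)) /remove_nth /= drop0.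
- exact: hang_child_bij.
- exact: hang_child_graph_map.
- by exists (hang_child js).
- exact: graph_map_can b'K (@hang_child_graph_map _ _ js).
move=> f /=; rewrite ffunE /fixes -(can_eq bK) b'K.
by rewrite -val_eqE.
Qed.

Lemma card_tree_graph t : #|tree_graph t| = nb_vertices t.
Proof.
rewrite -cardfE /vertices card_fseq undup_id ?addresses_uniq //.
elim/rtree_ind_all: t => ts IH; rewrite addressesE /=; congr S.
elim: ts 0%N IH => //= t ts ih m [IHt /ih IHts].
by rewrite child_edges_cons size_cat size_map IHt IHts.
Qed.

Lemma niso_neq0 t u : niso t u != 0%N -> nb_vertices t = nb_vertices u.
Proof. by rewrite -lt0n => /isos_card; rewrite !card_tree_graph. Qed.

Lemma niso_leaf us : niso leaf (Node us) = (us == [::]) :> nat.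
Proof.
case: us => [|u us] /=; last first.
  apply/eqP; case: eqVneq => // /niso_neq0 /= [].
  by have := nb_vertices_gt0 u; case: nb_vertices.
have all0 (v : tree_graph leaf) : v = tree_root leaf.
  by apply: val_inj; case: v => v /= H; move: (H); rewrite mem_vertices inE => /eqP.
rewrite /niso (_ : isos _ _ = [set finfun id]) ?cards1 //.
apply/setP => f; rewrite [RHS]inE; apply/idP/eqP => [_|->].
  by apply/ffunP => v; rewrite (all0 (f v)) ffunE (all0 v).
by apply: in_isos_finfun => //; exists id.
Qed.

Lemma niso_size ts us : niso (Node ts) (Node us) != 0%N -> size ts = size us.
Proof.
elim: ts us => [|t ts ih] us; first by rewrite niso_leaf; case: us.
rewrite niso_cons sum_nat_eq0 negb_forall => /existsP[[j js] /=].
rewrite muln_eq0 negb_or => /andP[_ /ih ->]; rewrite size_remove_nth //.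
by case: us js.
Qed.

(** * From isomorphism classes to weighted plane trees *)

(** Moving the j-th tree to the front is injective on these forests and preserves size and total
    rank, hence permutes the finite list. *)
Lemma perm_forests_front n m j : (j < n.+1)%N ->
  perm_eq [seq nth leaf us j :: remove_nth j us | us <- forests n.+1 m]
          (forests n.+1 m).
Proof.
move=> jn; set g := fun us => _.
have szE us : us \in forests n.+1 m -> (j < size us)%N.
  by rewrite mem_forests => /andP[/eqP -> _].
have ug : uniq (map g (forests n.+1 m)).
  rewrite map_inj_in_uniq ?forests_uniq // => us vs /szE ju /szE jv [En Er].
  have E s : (j < size s)%N -> s = take j s ++ nth leaf s j :: drop j.+1 s.
    by move=> js; rewrite -drop_nth ?cat_take_drop.
  have : take j us = take j vs /\ drop j.+1 us = drop j.+1 vs.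
    have /eqP := Er; rewrite eqseq_cat ?size_takel ?(ltnW ju) ?(ltnW jv) //.
    by move/andP => [/eqP -> /eqP ->].
  by move=> [Et Ed]; rewrite [LHS](E _ ju) [RHS](E _ jv) En Et Ed.
have sg : {subset map g (forests n.+1 m) <= forests n.+1 m}.
  move=> _ /mapP[us usf ->]; have ju := szE _ usf; move: usf; rewrite !mem_forests.
  have p : perm_eq us (g us) := perm_remove_nth leaf ju.
  by rewrite (perm_size p) (perm_sumn (perm_map rank p)).
apply: uniq_perm => //; first exact: forests_uniq.
by have [|_ E] := uniq_min_size ug sg; [rewrite size_map|exact: E].
Qed.

Section WeightedIsos.
Variable R : realType.
Local Notation w := (tree_weight R).

(** After expansion along the first tree, bringing the j-th tree to the front makes the n + 1 terms
    equal; each factors into 1 for t and n! for ts. *)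
Lemma sum_niso_forests ts :
  foldr (fun t => and (\sum_(u <- trees (rank t)) w u * (niso t u)%:R = 1)) True ts ->
  \sum_(us <- forests (size ts) (sumn (map rank ts)))
     \prod_(u <- us) w u * (niso (Node ts) (Node us))%:R = (size ts)`!%:R.
Proof.
elim: ts => [|t ts ih]; first by rewrite /= big_seq1 big_nil niso_leaf mul1r.
move=> [IHt /ih {}ih]; set m := sumn _; set n := size ts in ih.
rewrite -[size (t :: ts)]/(n.+1).
pose g u vs : R := (w u * (niso t u)%:R) *
  (\prod_(v <- vs) w v * (niso (Node ts) (Node vs))%:R).
transitivity (\sum_(us <- forests n.+1 m) \sum_(j < n.+1)
    g (nth leaf us j) (remove_nth j us)).
  rewrite big_seq [RHS]big_seq; apply: eq_bigr => us.
  rewrite mem_forests => /andP[/eqP sz _]; rewrite niso_cons sz natr_sum mulr_sumr.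
  apply: eq_bigr => j _; rewrite natrM /g.
  have js : (j < size us)%N by rewrite sz.
  by rewrite (perm_big _ (perm_remove_nth leaf js)) big_cons /=; ring.
rewrite exchange_big /=.
transitivity (\sum_(j < n.+1) \sum_(us <- forests n.+1 m)
   g (head leaf us) (behead us)).
  apply: eq_bigr => j _; rewrite -[RHS](perm_big _ (perm_forests_front m (ltn_ord j))).
  by rewrite big_map.
rewrite sumr_const card_ord -[LHS]mulr_natl factS natrM; congr (_ * _).
rewrite sum_forestsS.
have rm : (rank t < m.+1)%N by rewrite ltnS leq_addr.
rewrite (bigD1 (Ordinal rm)) //= [X in _ + X]big1 ?addr0 => [|a ra].
  rewrite [RHS](_ : _ = (\sum_(u <- trees (rank t)) w u * (niso t u)%:R) * n`!%:R).
    rewrite addKn mulr_suml; apply: eq_bigr => u _.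
    by rewrite -ih mulr_sumr.
  by rewrite IHt mul1r.
rewrite big_seq big1 // => u; rewrite mem_trees => /eqP ua.
rewrite big1 // => vs _; rewrite /g (_ : niso t u = 0%N) ?mulr0 ?mul0r //.
apply/eqP/negPn; apply: contra ra => /niso_neq0 tu.
by rewrite -val_eqE /= -ua /rank tu.
Qed.

Lemma sum_niso t : \sum_(u <- trees (rank t)) w u * (niso t u)%:R = 1.
Proof.
elim/rtree_ind_all: t => ts /sum_niso_forests E.
rewrite sum_trees rank_Node; set m := sumn _ in E *.
have sm : (size ts < (size ts + m).+1)%N by rewrite ltnS leq_addr.
rewrite (bigD1 (Ordinal sm)) //= [X in _ + X]big1 ?addr0 => [|n nt].
  transitivity ((size ts)`!%:R^-1 * (size ts)`!%:R : R); last first.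
    by rewrite mulVf // pnatr_eq0 -lt0n fact_gt0.
  rewrite addKn [X in _ = _ * X](esym E) mulr_sumr big_seq [RHS]big_seq; apply: eq_bigr => us.
  by rewrite mem_forests big_map => /andP[/eqP -> _]; rewrite mulrA.
rewrite big_seq big1 // => us; rewrite mem_forests => /andP[/eqP sz _].
rewrite (_ : niso _ _ = 0%N) ?mulr0 //; apply/eqP/negPn.
by apply: contra nt => /niso_size E'; rewrite -val_eqE /= -sz E'.
Qed.

End WeightedIsos.

Lemma isomorphic_niso t u : isomorphic t u -> niso t u = niso t t.
Proof.
move=> [f [bf gf]]; apply/esym.
exact: (@card_isos_r (tree_graph t) (tree_graph t) (tree_graph u) f bf gf).
Qed.

Lemma niso_isomorphic t u : (niso t u != 0%N) <-> isomorphic t u.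
Proof.
rewrite -lt0n; split=> [/card_gt0P[f /in_isos [bf gf]]|[f [bf gf]]].
  by exists f.
by apply/card_gt0P; exists (finfun f); exact: in_isos_finfun.
Qed.

Lemma sigma_niso t : sigma t = niso t t.
Proof.
pose F (s : {perm vertices t}) : {ffun tree_graph t -> tree_graph t} :=
  [ffun x => s x].
have Fi : injective F.
  by move=> s s' /ffunP E; apply/permP => x; have := E x; rewrite !ffunE.
rewrite /sigma -(card_imset _ Fi); apply: eq_card => f; apply/imsetP/in_isos.
  move=> [s]; rewrite inE => /asboolP gs ->; split.
    by apply: (eq_bij (f := s)) => [|x]; [exact/injF_bij/perm_inj|rewrite ffunE].
  by case: gs => gr ge; split=> [v|v v']; rewrite !ffunE; [exact: gr|exact: ge].
move=> [bf gf]; exists (perm (bij_inj bf)).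
  rewrite inE; apply/asboolP; case: gf => gr ge.
  by split=> [v|v v']; rewrite !permE; [exact: gr|exact: ge].
by apply/ffunP => x; rewrite ffunE permE.
Qed.

Lemma isomorphic_rank t u : isomorphic t u -> rank t = rank u.
Proof. by move/niso_isomorphic/niso_neq0; rewrite /rank => ->. Qed.

Lemma pi_RT_eq t u :
  ((\pi_RT t)%qT == (\pi_RT u)%qT :> RT) = `[< isomorphic t u >].
Proof. exact: (@eqquotE _ _ RT). Qed.

Lemma pi_rep u : isomorphic (rep (\pi_RT u)%qT) u.
Proof. by apply/asboolP; rewrite -pi_RT_eq /rep reprK. Qed.

(** Insert [sum_niso] for each class. Only plane trees in the class contribute, each with as many
    isomorphisms as the class has automorphisms, so 1/sigma is the total weight of the plane trees
    in the class. *)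
Lemma sum_RT (R : realType) k (G : rtree -> R) :
  (forall t u, isomorphic t u -> G t = G u) ->
  \sum_(c \in RT_of_size k.+1) (sigma (rep c))%:R^-1 * G (rep c) =
  \sum_(u <- trees k) tree_weight R u * G u.
Proof.
move=> GI; rewrite fsbig_finite //=; last exact: finite_RT_of_size.
set C := fset_set _.
have memC c : (c \in C) = (rank (rep c) == k).
  rewrite in_fset_set; last exact: finite_RT_of_size.
  have E : (nb_vertices (rep c) == k.+1) = (rank (rep c) == k).
    by rewrite /rank; have := nb_vertices_gt0 (rep c); case: nb_vertices.
  by rewrite -E; apply/idP/eqP => [/set_mem|H]; [|apply/mem_set].
have piE c u : ((\pi_RT u)%qT == c) = `[< isomorphic (rep c) u >].
  by rewrite -pi_RT_eq /rep reprK eq_sym.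
transitivity (\sum_(u <- trees k) \sum_(c <- C | (\pi_RT u)%qT == c)
    tree_weight R u * G u).
  rewrite (exchange_big_dep predT) //= big_seq [RHS]big_seq.
  apply: eq_bigr => c; rewrite memC => /eqP rc.
  transitivity (\sum_(u <- trees k | (\pi_RT u)%qT == c)
      tree_weight R u * G (rep c)); last first.
    by apply: eq_bigr => u; rewrite piE => /asboolP /GI ->.
  rewrite -mulr_suml; congr (_ * _).
  have := sum_niso R (rep c); rewrite rc.
  rewrite (bigID (fun u => (\pi_RT u)%qT == c)) /= [X in _ + X]big1 ?addr0.
    rewrite (eq_bigr (fun u => tree_weight R u * (sigma (rep c))%:R)).
      rewrite -mulr_suml => E; have s0 : (sigma (rep c))%:R != 0 :> R.
        rewrite pnatr_eq0 sigma_niso.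
        by apply/niso_isomorphic; exists id; split=> //; exists id.
      by rewrite -[RHS](mulfK s0) E div1r.
    by move=> u; rewrite piE sigma_niso => /asboolP /isomorphic_niso ->.
  move=> u; rewrite piE => /asboolP niu; suff -> : niso (rep c) u = 0%N by rewrite mulr0.
  by apply/eqP/negPn; apply/negP => /niso_isomorphic.
rewrite big_seq [RHS]big_seq; apply: eq_bigr => u; rewrite mem_trees => /eqP ru.
have uC : (\pi_RT u)%qT \in C.
  by rewrite memC (isomorphic_rank (pi_rep u)) ru.
rewrite big_mkcond (bigD1_seq (\pi_RT u)%qT) ?fset_uniq //= eqxx.
by rewrite big1 ?addr0 // => c; rewrite eq_sym => /negbTE ->.
Qed.

(** A nonzero count yields a matching of the children, which allows class invariance of [flow_coef]
    and [seldiff] to be proved by structural induction. *)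
Lemma niso_children ts us : niso (Node ts) (Node us) != 0%N ->
  exists2 vs, perm_eq us vs & all2 (fun t v => niso t v != 0%N) ts vs.
Proof.
elim: ts us => [|t ts ih] us; first by rewrite niso_leaf; case: us => //; exists [::].
rewrite niso_cons sum_nat_eq0 negb_forall => /existsP[[j js] /=].
rewrite muln_eq0 negb_or => /andP[tj /ih [vs pvs avs]].
exists (nth leaf us j :: vs); last by rewrite /= tj.
by rewrite (perm_trans (perm_remove_nth leaf js)) // perm_cons.
Qed.

Lemma flow_coef_iso (R : realType) t u :
  niso t u != 0%N -> flow_coef R t = flow_coef R u.
Proof.
elim/rtree_ind_all: t u => ts IH [us] /niso_children[vs pvs avs].
rewrite !flow_coefE (perm_big _ pvs) /=.
suff -> : \prod_(t <- ts) flow_coef R t = \prod_(t <- vs) flow_coef R t by [].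
elim: ts vs IH avs {pvs} => [|t ts ih] [|v vs] //=.
by move=> [IHt /ih IHts] /andP[/IHt tv /IHts E]; rewrite !big_cons tv E.
Qed.

(** * Elementary differentials as invariants of the isomorphism class *)

Section ElementaryDifferentials.
Context {R : realType} {d : nat}.
Variable X : 'I_d -> smoothfun R d.
Local Notation F := (seldiff X).

(** Symmetry of second derivatives: this is what makes the order of the children irrelevant. *)
Lemma diff_along_swap (D E : 'I_d -> smoothfun R d) Ds f :
  diff_along (D :: E :: Ds) f = diff_along (E :: D :: Ds) f.
Proof.
rewrite /=; under eq_bigr => i _ do rewrite mulr_sumr.
rewrite exchange_big; apply: eq_bigr => j _ /=; rewrite mulr_sumr.
by apply: eq_bigr => i _; rewrite /sdx sderiveC mulrCA.
Qed.

Lemma diff_along_front t ts us f :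
  diff_along (map F (ts ++ t :: us)) f = diff_along (map F (t :: ts ++ us)) f.
Proof.
elim: ts f => // s ts ih f; rewrite [RHS]diff_along_swap /=.
by apply: eq_bigr => i _; rewrite ih.
Qed.

Lemma diff_along_perm ts us f : perm_eq ts us ->
  diff_along (map F ts) f = diff_along (map F us) f.
Proof.
elim: ts us f => [|t ts ih] us f p.
  by have -> : us = [::] by apply/perm_nilP; rewrite perm_sym.
have tu : t \in us by rewrite -(perm_mem p) mem_head.
case/splitPr: tu p => u1 u2; rewrite perm_sym -[t :: u2]cat1s perm_catCA /= perm_cons perm_sym => p.
by rewrite diff_along_front /=; apply: eq_bigr => i _; rewrite (ih _ _ p).
Qed.

Lemma seldiff_iso t u : niso t u != 0%N -> F t = F u.
Proof.
elim/rtree_ind_all: t u => ts IH [us] /niso_children[vs pvs avs].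
apply/funext => i /=; rewrite (diff_along_perm _ pvs); congr (diff_along _ _).
elim: ts vs IH avs {pvs} => [|t ts ih] [|v vs] //=.
by move=> [IHt /ih IHts] /andP[/IHt -> /IHts ->].
Qed.

End ElementaryDifferentials.

(** * The series alpha as the flow at time 0 *)

Section Alpha.
Context {R : realType} {d : nat} (pi : 'I_d -> 'I_d -> 'rV[R]_d -> R).
Hypothesis Hpi : poisson_structure pi.
Let X : 'I_d -> smoothfun R d := vec (sp (R := R)) (spi Hpi).

Lemma alpha0 i z : alpha pi i 0 z = coord_x i z.
Proof.
rewrite /alpha (_ : RT_of_size 0 = set0) ?fsbig_set0 ?addr0 //.
by apply/seteqP; split=> // t; rewrite /RT_of_size /=; case: rep.
Qed.

Lemma alphaS i k z : alpha pi i k.+1 z =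
  \sum_(t <- trees k) tree_weight R t * seldiff X t i z * (flow_coef R t).[0].
Proof.
pose G t := tree_coef R t * eldiff (Vbar pi) t i z.
have XE : Vbar pi = fun j => X j by apply/funext => j; rewrite /X vecE.
have GE t : G t = (flow_coef R t).[0] * seldiff X t i z.
  by rewrite /G tree_coef_flow XE -seldiffE.
rewrite /alpha /= add0r.
transitivity (\sum_(t \in RT_of_size k.+1) (sigma (rep t))%:R^-1 * G (rep t)).
  by apply: eq_fsbigr => t _; rewrite mulrA.
rewrite sum_RT => [|t u /niso_isomorphic tu].
  by apply: eq_bigr => t _; rewrite GE mulrCA mulrA mulrAC mulrC mulrA mulrAC.
by rewrite !GE (flow_coef_iso _ tu) (seldiff_iso X tu).
Qed.

Lemma alpha_near_identity : near_identity (alpha pi).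
Proof.
move=> i; split=> [[|k]|z]; last exact: alpha0.
  rewrite (_ : alpha pi i 0%N = coord_x i); first exact: coord_x_smooth.
  by apply/funext => z; exact: alpha0.
pose f : smoothfun R d := \sum_(t <- trees k)
  scst (tree_weight R t) * seldiff X t i * scst (flow_coef R t).[0].
rewrite (_ : alpha pi i k.+1 = f); first exact: smoothfun_smooth.
by apply/funext => z; rewrite alphaS smoothfun_sum.
Qed.

Lemma alpha_karasev_equation : karasev_equation pi (alpha pi).
Proof.
move=> i k z; rewrite -(karasev_at (X := X) (fun j m => alphaS j m z)).
apply: eq_bigr => m _; rewrite -(phi_serE Hpi) fcomp0_subst //.
by move=> j; exact: alpha0.
Qed.

End Alpha.

Theorem theorem21 (R : realType) (d : nat)
    (pi : 'I_d -> 'I_d -> 'rV[R]_d -> R) (Hpi : poisson_structure pi) :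
  formal_symplectic_realization pi (alpha pi) /\
  formal_karasev_realization pi (alpha pi).
Proof.
have near_id := alpha_near_identity Hpi; have kar := alpha_karasev_equation Hpi.
split; first exact: karasev_equation_symplectic.
by split=> // s Hs Ks; exact: (karasev_unique Hpi).
Qed.
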